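(* Let $n\ge 1$, let $\mathcal{S}^n_+$ be the cone of real symmetric positive-definite $n\times n$ matrices, and let $F:\mathcal{S}^n_+\to\mathbb{R}$ be a $C^1$ function. Assume there are positive constants $k_1$, $C$, $k_2$ such that for every $\mathcal{B}\in\mathcal{S}^n_+$: (i) $DF(\mathcal{B})$ is positive-definite; (ii) $\exp F(\mathcal{B})\le C\left[(\operatorname{tr}\mathcal{B})^{k_1}+1\right]$; (iii) $\Vert DF(\mathcal{B})\cdot\mathcal{B}\Vert\le k_2$. Let $u:\mathbb{R}^n\to\mathbb{R}$ be a smooth strictly convex function satisfying, for all $x\in\mathbb{R}^n$, $$F\left(D^2u(x)\right)=\frac{1}{2}\,x\cdot Du(x)-u(x).$$ Then $u$ is quadratic.
   Context: For $\mathcal{B}=(b_{ij})\in\mathcal{S}^n_+$, $DF(\mathcal{B})$ is the matrix with entries $(DF)^{ij}(\mathcal{B})=\frac{\partial F}{\partial b_{ij}}(\mathcal{B})$, i.e. the symmetric matrix such that the differential of $F$ at $\mathcal{B}$ in the direction of a symmetric matrix $H$ equals $\operatorname{tr}(DF(\mathcal{B})H)$. $DF(\mathcal{B})\cdot\mathcal{B}$ is the matrix product, and $\Vert\cdot\Vert$ is the operator norm on $n\times n$ matrices (the choice of matrix norm is immaterial, all being equivalent). $Du$ is the gradient and $D^2u$ the Hessian matrix of $u$. A smooth function $u$ is strictly convex if $D^2u(x)$ is positive-definite at every point $x$. ''Quadratic'' means that $u$ is a polynomial of degree at most $2$ in $x_1,\dots,x_n$. *)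

(* Defs.v *)
From HB Require Import structures.
From mathcomp Require Import all_boot all_order all_algebra.
From mathcomp Require Import all_classical all_reals all_analysis.

Set Implicit Arguments.
Unset Strict Implicit.
Unset Printing Implicit Defensive.

Import Order.TTheory GRing.Theory Num.Theory.
Import numFieldNormedType.Exports.

Local Open Scope classical_set_scope.
Local Open Scope ring_scope.

Definition symmetric_mx (R : realType) (n : nat) (A : 'M[R]_n) : Prop :=
  A^T = A.

Definition posdef_mx (R : realType) (n : nat) (A : 'M[R]_n) : Prop :=
  symmetric_mx A /\
  forall x : 'rV[R]_n, x != 0 -> 0 < (x *m A *m x^T) 0 0.

Definition spd (R : realType) (n : nat) : set 'M[R]_n :=
  [set A | posdef_mx A].
Arguments spd : clear implicits.

Definition euclidean_norm (R : realType) (n : nat) (v : 'cV[R]_n) : R :=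
  Num.sqrt (\sum_(i < n) v i 0 ^+ 2).

(* The library's norm on matrices is the entrywise maximum. *)
Definition operator_norm (R : realType) (n : nat) (A : 'M[R]_n) : R :=
  sup [set euclidean_norm (A *m v) | v in
        [set v : 'cV[R]_n | euclidean_norm v <= 1]].

(* G is the gradient of F at B, where F is regarded as a function on the space
   of symmetric matrices: only symmetric increments H are tested, so for B in
   the open cone [spd R n] only the values of F on this cone are involved. *)
Definition is_sym_gradient (R : realType) (n : nat)
    (F : 'M[R]_n -> R) (B G : 'M[R]_n) : Prop :=
  symmetric_mx G /\
  forall e : R, 0 < e -> \forall H \near (0 : 'M[R]_n), symmetric_mx H ->
    `|F (B + H) - F B - \tr (G *m H)| <= e * `|H|.

Definition C1_on_spd (R : realType) (n : nat)
    (F : 'M[R]_n -> R) (DF : 'M[R]_n -> 'M[R]_n) : Prop :=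
  (forall B, spd R n B -> is_sym_gradient F B (DF B)) /\
  {within spd R n, continuous DF}.

Fixpoint Ck (R : realType) (n k : nat) (f : 'rV[R]_n -> R) : Prop :=
  if k is k'.+1 then
    (forall x, differentiable f x) /\
    (forall v : 'rV[R]_n, Ck k' (fun x => 'D_v f x))
  else continuous f.

Definition smooth (R : realType) (n : nat) (f : 'rV[R]_n -> R) : Prop :=
  forall k : nat, Ck k f.

Definition partial (R : realType) (n : nat) (i : 'I_n) (f : 'rV[R]_n -> R) :
    'rV[R]_n -> R :=
  fun x => 'D_(delta_mx 0 i) f x.

Definition gradient (R : realType) (n : nat) (u : 'rV[R]_n -> R)
    (x : 'rV[R]_n) : 'rV[R]_n :=
  \row_(i < n) partial i u x.

Definition hessian (R : realType) (n : nat) (u : 'rV[R]_n -> R)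
    (x : 'rV[R]_n) : 'M[R]_n :=
  \matrix_(i < n, j < n) partial i (partial j u) x.

Definition dot (R : realType) (n : nat) (x y : 'rV[R]_n) : R :=
  \sum_(i < n) x 0 i * y 0 i.

Definition strictly_convex (R : realType) (n : nat) (u : 'rV[R]_n -> R) :
    Prop :=
  forall x : 'rV[R]_n, posdef_mx (hessian u x).

Definition quadratic (R : realType) (n : nat) (u : 'rV[R]_n -> R) : Prop :=
  exists (a : 'M[R]_n) (b : 'rV[R]_n) (c : R), forall x : 'rV[R]_n,
    u x = \sum_(i < n) \sum_(j < n) a i j * x 0 i * x 0 j
          + \sum_(i < n) b 0 i * x 0 i + c.

(* Main.v *)
Require Import Defs.
From HB Require Import structures.
From mathcomp Require Import all_boot all_order all_algebra.
From mathcomp Require Import ring lra.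
From mathcomp Require Import all_classical all_reals all_analysis.
Import Order.TTheory GRing.Theory Num.Theory.
Import numFieldNormedType.Exports.
Local Open Scope ring_scope.

Set Implicit Arguments.
Unset Strict Implicit.
Unset Printing Implicit Defensive.

(* Write [Phi = x . Du / 2 - u], so that [F (D^2 u) = Phi]. Differentiating the
   equation along rays gives [x . D Phi / 2 = tr (DF D^2 Phi)], an elliptic
   equation without zeroth-order term, so [Phi] is constant as soon as it attains
   its maximum; and if [Phi] is constant then [D^2 u] is constant along rays.

   1. [U (x, t) = -t u (x / sqrt (-t))] satisfies [U_t = F (D^2 U)], whose
      right-hand side grows only logarithmically in [tr (D^2 U)] by (ii). Hence
      [e^(-la t) (1 - |x|^2) (U - M)] stays bounded as [t] tends to [0] whatever
      the lateral boundary values are, that is, [u] grows at most quadratically.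
   2. By convexity [Phi >= Phi x - 1] on a ball near [x] whose radius is a negative
      power of [|x|]. By 1 the trace of [D^2 u] is at most a power of [|x|]
      somewhere in this ball, and (ii) yields [Phi x = O(log |x|)].
   3. [v = u - u 0 - x . Du 0] grows at least linearly, and (iii) and convexity
      give [tr (DF D^2 v) - x . Dv / 2 <= n k2 - v / 2]. So the maximum of
      [Phi - eps v], which exists by 2, lies in the fixed compact set
      [v <= 2 n k2]; letting [eps] tend to [0], [Phi] attains its maximum. *)

(** * One-variable calculus: extrema and convexity *)

Section OneVariable.
Context {R : realType}.
Implicit Types (g : R -> R) (a b d : R).

Lemma is_derive_eps g a d : is_derive a 1 g d ->
  forall e, 0 < e -> exists2 del, 0 < del & forall h, `|h| < del ->
    `|g (a + h) - g a - d * h| <= e * `|h|.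
Proof.
case=> dg <- e e0.
have /cvgrPdist_le/(_ e e0) := dg.
rewrite -/('D_1 g a) => /nbhs_ballP[/= del del0 H]; exists del => // h hd.
have [->|h0] := eqVneq h 0; first by rewrite addr0 subrr mulr0 subrr normr0 mulr0.
have := H h; rewrite /ball /= sub0r normrN => /(_ hd h0).
have -> : h *: 1 + a = a + h by rewrite /GRing.scale /= mulr1 addrC.
rewrite /GRing.scale /= => {}H.
have -> : g (a + h) - g a - 'D_1 g a * h
   = - ('D_1 g a - h^-1 * (g (a + h) - g a)) * h.
  by field.
by rewrite normrM normrN ler_wpM2r.
Qed.

Lemma derive_left_max g a d : is_derive a 1 g d ->
  (exists2 del, 0 < del & forall t, 0 < t < del -> g (a - t) <= g a) -> 0 <= d.
Proof.
move=> dg [del del0 H]; rewrite leNgt; apply/negP => d0.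
have e0 : 0 < - d / 2 by lra.
have [del' del'0 H'] := is_derive_eps dg e0.
pose t := Num.min del del' / 2.
have m0 : 0 < Num.min del del' by rewrite lt_min del0.
have t0 : 0 < t by rewrite /t; lra.
have [td td'] : t < del /\ t < del'.
  have : t < Num.min del del' by rewrite /t; lra.
  by rewrite lt_min => /andP.
have Ht : g (a - t) <= g a by apply: H; rewrite t0.
have := H' (- t); rewrite normrN gtr0_norm // => /(_ td').
rewrite ler_norml => /andP[+ _].
nra.
Qed.

Lemma derive_local_max g a d : is_derive a 1 g d ->
  (exists2 del, 0 < del & forall t, `|t| < del -> g (a + t) <= g a) -> d = 0.
Proof.
move=> dg [del del0 H]; apply/eqP; rewrite eq_le; apply/andP; split; last first.
  apply: (derive_left_max dg); exists del => // t /andP[t0 td].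
  by apply: H; rewrite normrN gtr0_norm.
have dg' : is_derive (- a) 1 (g \o -%R) (d * -1).
  by apply: is_derive1_comp; rewrite opprK.
rewrite -oppr_ge0; rewrite mulrN1 in dg'.
apply: (derive_left_max dg'); exists del => // t /andP[t0 td] /=.
by rewrite opprD !opprK; apply: H; rewrite gtr0_norm.
Qed.

Lemma mvt (g g1 : R -> R) a b : (forall t : R, is_derive t 1 g (g1 t)) -> a < b ->
  exists2 c, a < c < b & g b - g a = g1 c * (b - a).
Proof.
move=> dg ab.
have dg' t : t \in `]a, b[ -> is_derive t 1 g (g1 t) by move=> _; exact: dg.
have cg : {within `[a, b]%classic, continuous g}%classic.
  apply: continuous_subspaceT => x.
  by apply/differentiable_continuous/derivable1_diffP; case: (dg x).
by have [c] := MVT ab dg' cg; rewrite in_itv /= => cab ->; exists c.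
Qed.

(** If [d] were positive, [g1], which vanishes at 0, would be positive just to the right of 0, and
    the mean value theorem would give [g t > g 0] there. *)
Lemma second_derivative_test (g g1 : R -> R) d : (forall t : R, is_derive t 1 g (g1 t)) ->
  is_derive (0 : R) 1 g1 d ->
  (exists2 del, 0 < del & forall t, `|t| < del -> g t <= g 0) ->
  g1 0 = 0 /\ d <= 0.
Proof.
move=> dg dg1 [del del0 H].
have g10 : g1 0 = 0.
  apply: (derive_local_max (dg 0)); exists del => // t td.
  by rewrite add0r; exact: H.
split=> //; rewrite leNgt; apply/negP => d0.
have e0 : 0 < d / 2 by lra.
have [del' del'0 H'] := is_derive_eps dg1 e0.
pose t := Num.min del del' / 2.
have m0 : 0 < Num.min del del' by rewrite lt_min del0.
have t0 : 0 < t by rewrite /t; lra.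
have [td td'] : t < del /\ t < del'.
  have : t < Num.min del del' by rewrite /t; lra.
  by rewrite lt_min => /andP.
have [c /andP[c0 ct] E] := mvt dg t0.
have Ht : g t <= g 0 by apply: H; rewrite gtr0_norm.
have := H' c; rewrite gtr0_norm // => /(_ (lt_trans ct td')).
rewrite add0r g10 subr0 ler_norml => /andP[+ _].
have : g1 c * t <= 0 by move: E; rewrite subr0; lra.
by rewrite pmulr_lle0 //; nra.
Qed.

Lemma monotone_derivative (g1 g2 : R -> R) : (forall t : R, is_derive t 1 g1 (g2 t)) ->
  (forall t, 0 <= g2 t) -> {homo g1 : s t / s <= t}.
Proof.
move=> dg g20 s t; rewrite le_eqVlt => /orP[/eqP->//|st].
have [c _ E] := mvt dg st; rewrite -subr_ge0 E mulr_ge0 //; lra.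
Qed.

Lemma convex_above_tangent (g g1 g2 : R -> R) : (forall t : R, is_derive t 1 g (g1 t)) ->
  (forall t : R, is_derive t 1 g1 (g2 t)) -> (forall t, 0 <= g2 t) ->
  forall a b, g a + g1 a * (b - a) <= g b.
Proof.
move=> dg dg1 g20 a b; have mono := monotone_derivative dg1 g20.
have [ab|ba|->] := ltgtP a b; last by rewrite subrr mulr0 addr0.
- have [c /andP[ac cb] E] := mvt dg ab.
  have := mono _ _ (ltW ac); nra.
- have [c /andP[bc ca] E] := mvt dg ba.
  have := mono _ _ (ltW ca); nra.
Qed.

End OneVariable.

(** * Derivatives along lines and symmetry of second derivatives *)

Section Lines.
Context {R : realType} {n : nat}.
Implicit Types (f : 'rV[R]_n -> R) (x y z : 'rV[R]_n) (c t : R).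

Lemma is_derive_line f x y t : differentiable f (x + t *: y) ->
  is_derive t 1 (fun s => f (x + s *: y)) ('D_y f (x + t *: y)).
Proof.
move=> df; have := diff_derivable (v := y) df.
have E : (fun h : R => h^-1 *: (((fun s => f (x + s *: y)) \o shift t) (h *: 1)
                         - f (x + t *: y)))
   = (fun h => h^-1 *: ((f \o shift (x + t *: y)) (h *: y) - f (x + t *: y))).
  apply/funext => h /=; congr (_ *: (f _ - _)).
  by rewrite (_ : h *: 1 = h) ?scalerDl 1?addrCA //; exact: mulr1.
move=> dv; split; first by rewrite /derivable E.
by rewrite /derive E.
Qed.

Lemma derive_lin f x y z c : differentiable f x ->
  'D_(c *: y + z) f x = c * 'D_y f x + 'D_z f x.
Proof. by move=> df; rewrite !deriveE // linearP. Qed.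

Lemma deriveZr f x y c : differentiable f x -> 'D_(c *: y) f x = c * 'D_y f x.
Proof. by move=> df; rewrite !deriveE // linearZ. Qed.

Lemma deriveDr f x y z : differentiable f x ->
  'D_(y + z) f x = 'D_y f x + 'D_z f x.
Proof. by move=> df; rewrite !deriveE // linearD. Qed.

Lemma derive_sum_partial f x y : differentiable f x ->
  'D_y f x = \sum_i y 0 i * partial i f x.
Proof.
move=> df; rewrite {1}[y]row_sum_delta deriveE // linear_sum.
by apply: eq_bigr => i _; rewrite linearZ /partial deriveE.
Qed.

Lemma smooth_derive f y : smooth f -> smooth (fun x => 'D_y f x).
Proof. by move=> sf k; have [_] := sf k.+1; exact. Qed.

Lemma smooth_diff f x : smooth f -> differentiable f x.
Proof. by move=> sf; have [] := sf 1%N. Qed.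

Lemma smooth_cont f : smooth f -> continuous f.
Proof. by move=> sf; exact: (sf 0%N). Qed.

Lemma smooth_line f x y t : smooth f ->
  is_derive t 1 (fun s => f (x + s *: y)) ('D_y f (x + t *: y)).
Proof. by move=> sf; apply: is_derive_line; exact: smooth_diff. Qed.

(** The mean value theorem is applied twice, in direction [a] to an increment in direction [b], then
    in direction [b] to ['D_a f]. The left-hand side is symmetric in [a] and [b], which is what
    makes mixed derivatives commute. *)
Lemma mixed_difference f x a b h : smooth f -> 0 < h ->
  exists s t, [/\ 0 < s < h, 0 < t < h &
    f (x + h *: a + h *: b) - f (x + h *: a) - f (x + h *: b) + f x =
    'D_b (fun z => 'D_a f z) (x + s *: a + t *: b) * h * h].
Proof.
move=> sf h0.
pose g s := f (x + h *: b + s *: a) - f (x + s *: a).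
have dg (s : R) : is_derive s 1 g ('D_a f (x + h *: b + s *: a) - 'D_a f (x + s *: a)).
  by apply: is_deriveB; exact: smooth_line.
have [s sh Es] := mvt dg h0.
pose k t := 'D_a f (x + s *: a + t *: b).
have dk (t : R) : is_derive t 1 k ('D_b (fun z => 'D_a f z) (x + s *: a + t *: b)).
  exact: (smooth_line _ _ _ (smooth_derive a sf)).
have [t th Et] := mvt dk h0.
exists s, t; split => //.
move: Es Et; rewrite /g /k !scale0r !addr0 !subr0 => Es <-.
have -> : x + s *: a + h *: b = x + h *: b + s *: a by rewrite addrAC.
rewrite -Es [x + h *: b + _]addrAC; ring.
Qed.

Lemma continuous_eps f x (e : R) : continuous f -> 0 < e ->
  exists2 del : R, 0 < del & forall y, `|y| < del -> `|f (x + y) - f x| <= e.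
Proof.
move=> cf e0; have /cvgrPdist_le/(_ e e0) := cf x.
move=> /nbhs_ballP[del /= del0 H]; exists del => // y yd.
rewrite distrC; apply: H; rewrite -ball_normE /ball_ /=.
by rewrite opprD addrA subrr sub0r normrN.
Qed.

Lemma norm_comb_lt (a b : 'rV[R]_n) (s t h m : R) :
  0 < h -> h * (`|a| + `|b| + 1) <= m ->
  0 < s < h -> 0 < t < h -> `|s *: a + t *: b| < m.
Proof.
move=> h0 hm /andP[s0 sh] /andP[t0 th].
apply: (le_lt_trans (ler_normD _ _)); rewrite !normrZ !gtr0_norm //.
have a0 : 0 <= `|a| by []. have b0 : 0 <= `|b| by [].
nra.
Qed.

(** The intermediate points given by [mixed_difference] for the two orders of differentiation
    differ, but both tend to [x] with [h]. *)
Lemma eq_at_limit (f1 f2 : 'rV[R]_n -> R) x (a b : 'rV[R]_n) :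
  continuous f1 -> continuous f2 ->
  (forall h : R, 0 < h -> exists s t s' t' : R,
     [/\ 0 < s < h, 0 < t < h, 0 < s' < h, 0 < t' < h &
      f1 (x + s *: a + t *: b) = f2 (x + s' *: b + t' *: a)]) ->
  f1 x = f2 x.
Proof.
move=> c1 c2 H.
apply/eqP; rewrite -subr_eq0 -normr_le0; apply/ler_addgt0Pl => e e0.
have e20 : 0 < e / 2 by lra.
have [d1 d10 H1] := continuous_eps x c1 e20.
have [d2 d20 H2] := continuous_eps x c2 e20.
pose m := Num.min d1 d2; have m0 : 0 < m by rewrite lt_min d10.
pose N : R := `|a| + `|b| + 1.
have N0 : 0 < N by rewrite /N ltr_wpDl // addr_ge0.
pose h := m / N; have h0 : 0 < h by rewrite divr_gt0.
have hN : h * N <= m by rewrite divfK ?lexx // lt0r_neq0.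
have hN' : h * (`|b| + `|a| + 1) <= m by rewrite (addrC `|b|).
have [s [t [s' [t' [sh th sh' th' E]]]]] := H h h0.
have m1 : m <= d1 by rewrite ge_min lexx.
have m2 : m <= d2 by rewrite ge_min lexx orbT.
have h1 := H1 _ (lt_le_trans (norm_comb_lt h0 hN sh th) m1).
have h2 := H2 _ (lt_le_trans (norm_comb_lt h0 hN' sh' th') m2).
move: h1 h2; rewrite !addrA -E addr0 !ler_norml => /andP[? ?] /andP[? ?].
by apply/andP; split; lra.
Qed.

Lemma smooth_schwarz f x (a b : 'rV[R]_n) : smooth f ->
  'D_b (fun z => 'D_a f z) x = 'D_a (fun z => 'D_b f z) x.
Proof.
move=> sf.
have c1 := smooth_cont (smooth_derive b (smooth_derive a sf)).
have c2 := smooth_cont (smooth_derive a (smooth_derive b sf)).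
apply: (eq_at_limit (a := a) (b := b) c1 c2) => h h0.
have [s [t [sh th E1]]] := mixed_difference x a b sf h0.
have [s' [t' [sh' th' E2]]] := mixed_difference x b a sf h0.
exists s, t, s', t'; split; [by []|by []|by []|by []|].
apply: (mulIf (lt0r_neq0 h0)); apply: (mulIf (lt0r_neq0 h0)).
apply: (etrans (esym E1)); apply: (etrans _ E2).
by rewrite [x + h *: b + _]addrAC; congr (_ + _); exact: addrAC.
Qed.

End Lines.

(** * Positive-definite matrices and the operator norm *)

Section PositiveDefinite.
Context {R : realType}.

(** Induction by Schur complement: with first row [r] and corner entry [a], the matrix
    [a^-1 *: (r^T *m r)] accounts for the first row and column, and the remaining block [S] is again
    positive-definite. *)
Lemma posdef_rank_one_sum n (A : 'M[R]_n) : posdef_mx A ->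
  exists s : seq 'rV[R]_n, A = \sum_(y <- s) y^T *m y.
Proof.
elim: n A => [|n IH] A [symA posA].
  by exists [::]; apply/matrixP => -[].
pose A' : 'M[R]_(1 + n) := A.
pose a := A 0 0; pose b := ursubmx A'; pose D := drsubmx A'.
have symA' : A'^T = A' by exact: symA.
have A'E : A' = block_mx a%:M b b^T D.
  rewrite -[LHS]submxK; congr block_mx.
    rewrite [LHS]mx11_scalar; congr (_%:M).
    by rewrite !mxE; congr (A _ _); apply/val_inj.
  by rewrite /b trmx_ursub symA'.
have symD : D^T = D by rewrite /D trmx_drsub symA'.
have a0 : 0 < a.
  have := posA (delta_mx 0 0); rewrite -rowE trmx_delta -colE !mxE; apply.
  apply/eqP => /matrixP/(_ 0 0); rewrite !mxE eqxx /= => /eqP.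
  by rewrite oner_eq0.
pose S := D - a^-1 *: (b^T *m b).
have [s Ss] : exists s : seq 'rV[R]_n, S = \sum_(y <- s) y^T *m y.
  apply: IH; split.
    by rewrite /symmetric_mx linearB linearZ /= trmx_mul trmxK symD.
  move=> z z0.
  (* This first coordinate makes the first block of [x *m A'] vanish, so the form of [A'] at [x]
     equals the form of [S] at [z]. *)
  pose t : 'M[R]_1 := - (a^-1 *: (z *m b^T)).
  pose x : 'rV[R]_(1 + n) := row_mx t z.
  have : x != 0 -> 0 < (x *m A' *m x^T) 0 0 by exact: posA.
  rewrite A'E /x tr_row_mx mul_row_block mul_row_col.
  have -> : t *m a%:M + z *m b^T = 0.
    rewrite mul_mx_scalar /t scalerN scalerA divff ?lt0r_neq0 //.
    by rewrite scale1r addNr.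
  rewrite mul0mx add0r /t /S => H.
  rewrite mulmxBr -scalemxAr mulmxA [X in X *m _]addrC scalemxAl -mulNmx; apply: H.
  apply: contraNneq z0 => /eqP; rewrite -[0]row_mx0 => /eqP/eq_row_mx [_ ->].
  by [].
pose r : 'rV[R]_(1 + n) := row_mx a%:M b.
pose pad (y : 'rV[R]_n) : 'rV[R]_(1 + n) := row_mx 0 y.
have padE y : (pad y)^T *m pad y = block_mx 0 0 0 (y^T *m y) :> 'M[R]_(1 + n).
  by rewrite /pad tr_row_mx mul_col_row !(trmx0, mul0mx, mulmx0).
exists (Num.sqrt a^-1 *: r :: map pad s).
rewrite big_cons -[LHS]/A' A'E.
have -> : (Num.sqrt a^-1 *: r)^T *m (Num.sqrt a^-1 *: r) = a^-1 *: (r^T *m r).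
  rewrite -scalemxAr linearZ /= -scalemxAl scalerA -expr2.
  by rewrite sqr_sqrtr // invr_ge0 ltW.
have -> : block_mx a%:M b b^T D =
    a^-1 *: (r^T *m r) + block_mx 0 0 0 S :> 'M[R]_(1 + n).
  rewrite /r tr_row_mx mul_col_row tr_scalar_mx scale_block_mx add_block_mx.
  rewrite !addr0 -scalar_mxM scale_scalar_mx mulKf ?lt0r_neq0 //.
  rewrite mul_scalar_mx mul_mx_scalar !scalerA mulVf ?lt0r_neq0 // !scale1r.
  by rewrite /S addrC subrK.
congr (_ + _).
rewrite big_map Ss; elim: (s) => [|y l IHl]; first by rewrite !big_nil block_mx0.
rewrite !big_cons -{}IHl padE.
have := @add_block_mx R 1 n 1 n 0 0 0 (y^T *m y) 0 0 0 (\sum_(j <- l) j^T *m j).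
by rewrite /= !addr0 => /esym.
Qed.

Lemma tr_rank_one_sum n (s : seq 'rV[R]_n) (B : 'M[R]_n) :
  \tr ((\sum_(y <- s) y^T *m y) *m B) = \sum_(y <- s) (y *m B *m y^T) 0 0.
Proof.
rewrite mulmx_suml linear_sum; apply: eq_bigr => y _.
by rewrite /= -mulmxA mxtrace_mulC [LHS]big_ord1.
Qed.

(** Each diagonal entry is a coordinate of the image of a unit vector, hence at most the operator
    norm. *)
Lemma tr_le_operator_norm n (M : 'M[R]_n) : \tr M <= n%:R * operator_norm M.
Proof.
rewrite -[n in n%:R]card_ord mulr_natl -sumr_const; apply: ler_sum => i _.
pose e : 'cV[R]_n := delta_mx i 0.
have enorm : euclidean_norm e = 1.
  rewrite /euclidean_norm (bigD1 i) //= big1 => [|j ji].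
    by rewrite !mxE !eqxx addr0 expr1n sqrtr1.
  by rewrite !mxE (negbTE ji) expr0n.
have coord_le (v : 'cV[R]_n) j : `|v j 0| <= euclidean_norm v.
  rewrite -sqrtr_sqr /euclidean_norm ler_sqrt ?sumr_ge0 // => [|k _].
    by rewrite (bigD1 j) //= lerDl sumr_ge0 // => k _; rewrite sqr_ge0.
  by rewrite sqr_ge0.
apply: (@le_trans _ _ (euclidean_norm (M *m e))).
  apply: (le_trans _ (coord_le _ i)); rewrite -colE mxE; exact: ler_norm.
apply: ub_le_sup; last by exists e => //=; rewrite enorm.
(* A [sup] dominates its elements only when the set is bounded above; this bound comes from
   [|v k 0| <= 1]. *)
exists (Num.sqrt (\sum_j (\sum_k `|M j k|) ^+ 2)) => _ [v /= v1 <-].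
rewrite ler_wsqrtr // ler_sum // => j _.
rewrite -real_normK ?num_real // ler_pXn2r ?nnegrE ?sumr_ge0 //.
rewrite mxE (le_trans (ler_norm_sum _ _ _)) // ler_sum // => k _.
by rewrite normrM ler_piMr // (le_trans (coord_le _ _)).
Qed.

End PositiveDefinite.

(** * The function [Phi] along lines *)

Section SelfShrinker.
Context {R : realType} {n : nat}.
Implicit Types (u : 'rV[R]_n -> R) (x y : 'rV[R]_n) (t : R).

Definition hess2 y u x := 'D_y (fun z => 'D_y u z) x.

Lemma hessian_form u x y : smooth u ->
  (y *m hessian u x *m y^T) 0 0 = hess2 y u x.
Proof.
move=> su; rewrite /hess2 derive_sum_partial; last first.
  exact: smooth_diff (smooth_derive _ su).
rewrite mxE; apply: eq_bigr => j _; rewrite !mxE mulrC; congr (_ * _).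
rewrite /partial smooth_schwarz // derive_sum_partial; last first.
  exact: smooth_diff (smooth_derive _ su).
by apply: eq_bigr => i _; rewrite mxE.
Qed.

Lemma dot_gradient u x : differentiable u x -> dot x (gradient u x) = 'D_x u x.
Proof.
move=> du; rewrite derive_sum_partial //; apply: eq_bigr => i _.
by rewrite mxE.
Qed.

(* With [Phi = x . Du / 2 - u], [dPhi] and [ddPhi] are the first two
   derivatives of [Phi] along the line [x + t y]. *)
Definition Phi u x := 2^-1 * 'D_x u x - u x.

Definition dPhi u x y t :=
  2^-1 * ('D_y (fun z => 'D_x u z) (x + t *: y) + t * hess2 y u (x + t *: y)
          - 'D_y u (x + t *: y)).

Definition ddPhi u x y t :=
  2^-1 * (hess2 y (fun z => 'D_x u z) (x + t *: y)
          + t * 'D_y (hess2 y u) (x + t *: y)).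

(** Meant for [a], [b], [c] equal to ['D_x u], ['D_y u], [u] along [x + s y]: then [a s + s * b s]
    is the radial derivative of [u], and [c' = b] absorbs part of its derivative. *)
Lemma is_derive_half_euler (a b c : R -> R) (a' b' t : R) :
  is_derive t 1 a a' -> is_derive t 1 b b' -> is_derive t 1 c (b t) ->
  is_derive t 1 (fun s => 2^-1 * (a s + s * b s) - c s)
    (2^-1 * (a' + t * b' - b t)).
Proof.
by move=> da db dc; apply: is_derive_eq; rewrite /GRing.scale /=; field.
Qed.

(** The same one order higher. Now the terms [b t] cancel completely, which is why the linearized
    equation has no zeroth-order term. *)
Lemma is_derive_half_euler' (a b c : R -> R) (a' b' t : R) :
  is_derive t 1 a a' -> is_derive t 1 b b' -> is_derive t 1 c (b t) ->
  is_derive t 1 (fun s => 2^-1 * (a s + s * b s - c s))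
    (2^-1 * (a' + t * b')).
Proof.
by move=> da db dc; apply: is_derive_eq; rewrite /GRing.scale /=; field.
Qed.

Lemma is_derive_Phi u x y t : smooth u ->
  is_derive t 1 (fun s => Phi u (x + s *: y)) (dPhi u x y t).
Proof.
move=> su.
have -> : (fun s => Phi u (x + s *: y)) = (fun s => 2^-1 *
    ('D_x u (x + s *: y) + s * 'D_y u (x + s *: y)) - u (x + s *: y)).
  by apply/funext => s; rewrite /Phi deriveDr ?deriveZr //; exact: smooth_diff.
have d0 := smooth_line x y t su.
have d1 := smooth_line x y t (smooth_derive x su).
have d2 := smooth_line x y t (smooth_derive y su).
exact: (is_derive_half_euler d1 d2 d0).
Qed.

Lemma is_derive_dPhi u x y t : smooth u ->
  is_derive t 1 (dPhi u x y) (ddPhi u x y t).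
Proof.
move=> su.
have d0 := smooth_line x y t (smooth_derive y su).
have d1 := smooth_line x y t (smooth_derive y (smooth_derive x su)).
have d2 := smooth_line x y t (smooth_derive y (smooth_derive y su)).
exact: (is_derive_half_euler' d1 d2 d0).
Qed.

(** The direction [z] stays frozen while symmetry of second derivatives, used twice, moves ['D_z]
    inside both partial derivatives. *)
Lemma derive_hessian u x (z : 'rV[R]_n) : smooth u -> forall i j,
  is_derive (0 : R) 1 (fun s => hessian u (x + s *: z) i j)
    (hessian (fun w => 'D_z u w) x i j).
Proof.
move=> su i j.
have -> : (fun s : R => hessian u (x + s *: z) i j) =
    (fun s => partial i (partial j u) (x + s *: z)).
  by apply/funext => s; rewrite mxE.
have d := smooth_line x z 0 (smooth_derive (delta_mx 0 i)
   (smooth_derive (delta_mx 0 j) su)).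
apply: (is_derive_eq d); rewrite scale0r addr0 mxE.
apply: (etrans (smooth_schwarz x (delta_mx 0 i) z
  (smooth_derive (delta_mx 0 j) su))).
suff E : (fun w => 'D_z (fun v => 'D_(delta_mx 0 j) u v) w)
       = (fun w => 'D_(delta_mx 0 j) (fun v => 'D_z u v) w).
  exact: (congr1 (fun g => 'D_(delta_mx 0 i) g x) E).
by apply/funext => w; exact: (smooth_schwarz w (delta_mx 0 j) z su).
Qed.

End SelfShrinker.

(** * Chain rule along curves of symmetric matrices *)

Section ChainRule.
Context {R : realType} {n : nat}.

(** Since [is_sym_gradient] tests symmetric increments only, the curve has to stay symmetric. The
    derivative [d] is given, later by smoothness of [Phi]; what is proved is its value. *)
Lemma sym_gradient_curve (F : 'M[R]_n -> R) (G : 'M[R]_n) (H : R -> 'M[R]_n)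
    (H' : 'M[R]_n) (d : R) :
  is_sym_gradient F (H 0) G -> (forall t, symmetric_mx (H t)) ->
  (forall i j, is_derive (0 : R) 1 (fun t => H t i j) (H' i j)) ->
  is_derive (0 : R) 1 (fun t => F (H t)) d -> d = \tr (G *m H').
Proof.
move=> [_ dF] symH dH dFH.
have Hder : derivable H 0 1 by apply/derivable_mxP => i j; case: (dH i j).
have Hder' : 'D_1 H 0 = H'.
  by rewrite derive_mx //; apply/matrixP => i j; rewrite mxE; case: (dH i j).
have dtr : is_derive (0 : R) 1 (fun t => \tr (G *m (H t - H 0))) (\tr (G *m H')).
  have -> : (fun t => \tr (G *m (H t - H 0))) =
      \sum_i \sum_j (fun t => G i j * (H t j i - H 0 j i)).
    apply/funext => t; rewrite fct_sumE; apply: eq_bigr => i _.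
    by rewrite fct_sumE mxE; apply: eq_bigr => j _; rewrite !mxE.
  apply: is_derive_eq; apply: eq_bigr => i _; rewrite mxE.
  apply: eq_bigr => j _; rewrite /GRing.scale /=; ring.
pose K := `|H'| + 1; have K0 : 0 < K by rewrite ltr_wpDl.
(* The curve is Lipschitz at 0, so an error small against [H t - H 0] is small against [t]. *)
have Hbound : exists2 del, 0 < del & forall t, `|t| < del ->
    `|H t - H 0| <= K * `|t|.
  have := Hder; rewrite /derivable => /cvgrPdist_le/(_ 1 ltr01).
  rewrite -/('D_1 H 0) Hder' => /nbhs_ballP[/= del del0 Hd]; exists del => // t td.
  have [->|t0] := eqVneq t 0; first by rewrite subrr !normr0 mulr0.
  have := Hd t; rewrite /ball /= sub0r normrN => /(_ td t0).
  rewrite addr0 (_ : t *: 1 = t); last exact: mulr1.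
  set D := H t - H 0 => HD.
  have : `|t^-1 *: D| <= K.
    by rewrite -[_ *: D](subKr H') (le_trans (ler_normB _ _)) // lerD2l.
  by rewrite normrZ normfV mulrC ler_pdivrMr ?normr_gt0.
have [del2 del20 Hb] := Hbound.
have dk := is_deriveB dFH dtr.
apply/eqP; rewrite -subr_eq0 -normr_le0; apply/ler_addgt0Pl => e e0.
have e20 : 0 < e / (2 * K) by rewrite divr_gt0 // mulr_gt0.
have e40 : 0 < e / 2 by lra.
have [del1 del10 Hd] := is_derive_eps dk e40.
have /nbhs_ballP[del3 /= del30 Hf] := dF _ e20.
(* At one [t > 0] below all three thresholds both errors are at most [e / 2 * t], whence
   [|d - T| * t <= e * t]. *)
pose m := Num.min (Num.min del1 del2) (del3 / K).
have m0 : 0 < m by rewrite !lt_min del10 del20 divr_gt0.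
pose t := m / 2; have t0 : 0 < t by rewrite divr_gt0.
have tm : t < m by rewrite /t; lra.
have /and3P[td1 td2 td3] : [&& t < del1, t < del2 & t < del3 / K].
  by move: tm; rewrite /m !lt_min => /andP[/andP[-> ->] ->].
have tn : `|t| = t by rewrite gtr0_norm.
have Hbt := Hb t; rewrite tn in Hbt; have {}Hbt := Hbt td2.
have HDt : `|H t - H 0| < del3.
  by apply: (le_lt_trans Hbt); rewrite mulrC -ltr_pdivlMr.
have HB : ball (0 : 'M[R]_n) del3 (H t - H 0).
  by rewrite -ball_normE /ball_ /= sub0r normrN.
have symD : symmetric_mx (H t - H 0).
  by rewrite /symmetric_mx linearB /= !symH.
have E : H 0 + (H t - H 0) = H t by rewrite addrC subrK.
have {}Hf := Hf _ HB symD; rewrite E in Hf.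
have {Hd} := Hd t; rewrite tn => /(_ td1).
rewrite !fctE add0r subrr mulmx0 mxtrace0 subr0.
have {}Hf : `|F (H t) - F (H 0) - \tr (G *m (H t - H 0))| <= e / 2 * t.
  apply: (le_trans Hf); rewrite -[leRHS]mulr1.
  apply: (@le_trans _ _ (e / (2 * K) * (K * t))).
    by rewrite ler_wpM2l // ltW.
  by rewrite le_eqVlt; apply/orP; left; apply/eqP; field; rewrite lt0r_neq0.
move: Hf; move: (F (H t)) (F (H 0)) (\tr (G *m (H t - H 0))) (\tr (G *m H')).
move=> X Y Q T Hf Hd.
have : `|d - T| * t <= e * t.
  rewrite -[X in _ * X <= _]tn -normrM.
  have -> : (d - T) * t = (X - Y - Q) - (X - Q - Y - (d - T) * t) by ring.
  have -> : e * t = e / 2 * t + e / 2 * t by field.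
  exact: (le_trans (ler_normB _ _) (lerD Hf Hd)).
by rewrite addr0 ler_pM2r.
Qed.

End ChainRule.

(** * Linearization of the equation along rays *)

Section LinearizedEquation.
Context {R : realType} {n : nat}.
Variables (F : 'M[R]_n -> R) (DF : 'M[R]_n -> 'M[R]_n) (k2 : R).
Hypothesis F_grad : forall B, spd R n B -> is_sym_gradient F B (DF B).
Hypothesis DF_posdef : forall B : 'M[R]_n, spd R n B -> posdef_mx (DF B).
Hypothesis DF_bound : forall B : 'M[R]_n, spd R n B ->
  operator_norm (DF B *m B) <= k2.
Variable u : 'rV[R]_n -> R.
Hypotheses (u_smooth : smooth u) (u_convex : strictly_convex u).
Hypothesis u_eq : forall x : 'rV[R]_n, F (hessian u x) = Phi u x.

(* Rank-one decomposition of [DF] makes every second-order operator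
   [tr (DF D^2 f)] a sum of second derivatives along lines. *)
Lemma linearized_equation (x : 'rV[R]_n) : exists s : seq 'rV[R]_n,
  [/\ DF (hessian u x) = \sum_(y <- s) y^T *m y,
      dPhi u x x 0 = 2 * \sum_(y <- s) ddPhi u x y 0 &
      \sum_(y <- s) hess2 y u x <= n%:R * k2].
Proof.
have [s sE] := posdef_rank_one_sum (DF_posdef (u_convex x)).
exists s; split => //.
- have dF := is_derive_Phi x x 0 u_smooth.
  have {}dF : is_derive (0 : R) 1 (fun t => F (hessian u (x + t *: x))) (dPhi u x x 0).
    rewrite (_ : (fun t => _) = (fun t => Phi u (x + t *: x))) //.
    by apply/funext => t; exact: u_eq.
  have grad : is_sym_gradient F (hessian u (x + (0 : R) *: x)) (DF (hessian u x)).
    by rewrite scale0r addr0; apply: F_grad; exact: u_convex.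
  have sym t : symmetric_mx (hessian u (x + t *: x)) by have [] := u_convex (x + t *: x).
  rewrite (sym_gradient_curve grad sym (derive_hessian x x u_smooth) dF).
  rewrite sE tr_rank_one_sum mulr_sumr; apply: eq_bigr => y _.
  (* At parameter 0, [ddPhi u x y] is half the second derivative of ['D_x u] with [x] frozen as
     direction, which is what the derivative of the Hessian along the ray produces. *)
  rewrite hessian_form; last exact: smooth_derive.
  by rewrite /ddPhi scale0r addr0 mul0r addr0 mulVKf.
- have -> : \sum_(y <- s) hess2 y u x = \tr (DF (hessian u x) *m hessian u x).
    rewrite sE tr_rank_one_sum; apply: eq_bigr => y _.
    by rewrite hessian_form.
  apply: (le_trans (tr_le_operator_norm _)).
  by rewrite ler_wpM2l //; apply: DF_bound; exact: u_convex.
Qed.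

End LinearizedEquation.

(** * The Euclidean square and its compact balls *)

Section EuclideanSquare.
Context {R : realType} {n : nat}.
Implicit Types (x y q : 'rV[R]_n).

Lemma continuous_sumr (f : 'I_n -> 'rV[R]_n -> R) :
  (forall i, continuous (f i)) -> continuous (fun x => \sum_i f i x).
Proof.
move=> cf; apply: continuous_big => [|i _]; last exact: cf.
exact: add_continuous.
Qed.

Lemma dotC x y : dot x y = dot y x.
Proof. by apply: eq_bigr => i _; rewrite mulrC. Qed.

Lemma dotDl x y q : dot (x + y) q = dot x q + dot y q.
Proof. by rewrite -big_split; apply: eq_bigr => i _; rewrite mxE mulrDl. Qed.

Lemma dotZl (c : R) x q : dot (c *: x) q = c * dot x q.
Proof. by rewrite mulr_sumr; apply: eq_bigr => i _; rewrite mxE mulrA. Qed.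

Lemma dotDr x y q : dot q (x + y) = dot q x + dot q y.
Proof. by rewrite !(dotC q) dotDl. Qed.

Lemma dotZr (c : R) x q : dot q (c *: x) = c * dot q x.
Proof. by rewrite !(dotC q) dotZl. Qed.

(** Unlike the maximum norm [|x|], this is a quadratic polynomial along every line, as the
    second-derivative tests require. *)
Definition sq x := dot x x.

Lemma sq_ge0 x : 0 <= sq x.
Proof. by apply: sumr_ge0 => i _; rewrite -expr2 sqr_ge0. Qed.

Lemma sq0 : sq 0 = 0.
Proof. by apply: big1 => i _; rewrite mxE mul0r. Qed.

Lemma sqZ (c : R) x : sq (c *: x) = c ^+ 2 * sq x.
Proof. by rewrite /sq dotZl dotZr mulrA. Qed.

Lemma sqD x y : sq (x + y) = sq x + 2 * dot x y + sq y.
Proof. rewrite /sq !dotDl !dotDr (dotC y x); ring. Qed.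

Lemma sqN x : sq (- x) = sq x.
Proof. by rewrite -scaleN1r sqZ sqrrN expr1n mul1r. Qed.

Lemma sq_gt0 x : x != 0 -> 0 < sq x.
Proof.
move=> x0; rewrite lt_neqAle sq_ge0 andbT eq_sym; apply: contra x0 => /eqP s0.
have x20 i : true -> 0 <= x 0 i * x 0 i by rewrite -expr2 sqr_ge0.
apply/eqP/rowP => i; rewrite mxE; apply/eqP; rewrite -sqrf_eq0 expr2; apply/eqP.
exact: (psumr_eq0P x20 s0).
Qed.

Lemma dot_delta x i : dot x (delta_mx 0 i) = x 0 i.
Proof.
rewrite /dot (bigD1 i) //= big1 => [|j ji]; rewrite mxE eqxx ?eqxx ?mulr1 ?addr0 //.
by rewrite (negbTE ji) mulr0.
Qed.

Lemma sq_delta i : sq (delta_mx 0 i : 'rV[R]_n) = 1.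
Proof. by rewrite /sq dot_delta mxE !eqxx. Qed.

Lemma continuous_sq : continuous sq.
Proof.
apply: continuous_sumr => i x.
by apply: continuousM; exact: coord_continuous.
Qed.

Lemma continuous_sqB q : continuous (fun x => sq (x - q)).
Proof.
move=> x; pose g z : 'rV[R]_n := z - q.
suff cg : {for x, continuous g} by exact: continuous_comp cg (@continuous_sq _).
by apply: (@continuousB _ _ _ id (cst q)); [exact: cvg_id|exact: cst_continuous].
Qed.

Lemma normr_le_sq x : `|x| <= 1 + sq x.
Proof.
rewrite [leLHS]mx_normrE bigmax_le ?addr_ge0 ?sq_ge0 // => -[i j] _ /=.
rewrite ord1 (@le_trans _ _ (1 + x 0 j * x 0 j)) //.
  by rewrite ler_norml; apply/andP; split; nra.
rewrite lerD2l /sq /dot (bigD1 j) //= lerDl sumr_ge0 // => k _.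
by rewrite -expr2 sqr_ge0.
Qed.

(** The parameter [r] is the square of the radius. *)
Definition cball q (r : R) : set 'rV[R]_n := [set x | sq (x - q) <= r]%classic.

Lemma compact_cball q r : compact (cball q r).
Proof.
apply: bounded_closed_compact; last first.
  apply: (@preimage_closed _ _ (fun x => sq (x - q)) [set x | x <= r]%classic).
    by move=> x _; exact: continuous_sqB.
  exact: closed_le.
exists (`|q| + (1 + r)); split; first exact: num_real.
move=> M hM x /= xr; rewrite -[x](subrK q) (le_trans (ler_normD _ _)) //.
rewrite addrC (le_trans _ (ltW hM)) // lerD2l.
by rewrite (le_trans (normr_le_sq _)) // lerD2l.
Qed.

Lemma near_line (f : 'rV[R]_n -> R) p y (e : R) : continuous f -> 0 < e ->
  exists2 del : R, 0 < del & forall t : R, `|t| < del ->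
    `|f (p + t *: y) - f p| <= e.
Proof.
move=> cf e0; have [del del0 H] := continuous_eps p cf e0.
exists (del / (`|y| + 1)) => [|t td].
  by rewrite divr_gt0 // ltr_wpDl.
apply: H; rewrite normrZ (@le_lt_trans _ _ (`|t| * (`|y| + 1))) //.
  by rewrite ler_wpM2l // lerDl.
by rewrite -ltr_pdivlMr // ltr_wpDl.
Qed.

Lemma near_line_lt (f : 'rV[R]_n -> R) p y (c : R) : continuous f -> f p < c ->
  exists2 del : R, 0 < del & forall t : R, `|t| < del -> f (p + t *: y) < c.
Proof.
move=> cf fc; have e0 : 0 < (c - f p) / 2 by lra.
have [del del0 H] := near_line p y cf e0.
by exists del => // t /H; rewrite ler_norml => /andP[_ ?]; lra.
Qed.

End EuclideanSquare.

(** * Scalar tools for the growth estimates *)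

Section GrowthTools.
Context {R : realType}.

(** If the trace [T] is polynomially bounded in [z], hypothesis (ii) is incompatible with
    [Phi >= lam * z]. The bound on [T] gives [T <= expR ((N + m) * z)]. *)
Lemma exp_beats_power (C k1 N : R) (m : nat) : 0 < C -> 0 < k1 -> 0 < N ->
  exists lam : R, forall z T, 1 <= z -> 0 <= T -> T <= N * z ^+ m ->
    C * (T `^ k1 + 1) < expR (lam * z).
Proof.
move=> C0 k0 N0; pose k := k1 * (N + m%:R).
have kpos : 0 < k by rewrite mulr_gt0 // ltr_wpDr.
(* The three summands serve to dominate [C], the factor 2, and [T] to the power [k1], in this
   order. *)
exists (C + 1 + k) => z T z1 T0 TN.
have ez : z <= expR z by have := expR_ge1Dx z; lra.
have z0 : 0 <= z by lra.
have eT : T <= expR ((N + m%:R) * z).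
  apply: (le_trans TN); rewrite mulrDl expRD ler_pM ?exprn_ge0 ?(ltW N0) //.
    have := expR_ge1Dx (N * z); nra.
  by rewrite expRM_natl; apply: lerXn2r; rewrite ?nnegrE ?expR_ge0.
have eTk : T `^ k1 <= expR (k * z).
  have -> : k * z = ((N + m%:R) * z) * k1 by rewrite /k; ring.
  by rewrite expRM ge0_ler_powR ?nnegrE ?expR_ge0 // ltW.
have ek : 1 <= expR (k * z) by rewrite -expR0 ler_expR mulr_ge0 // ltW.
have eC : C < expR (C * z).
  have := expR_ge1Dx (C * z); nra.
have e1 : 2 <= expR z by have := expR_ge1Dx z; lra.
rewrite !mulrDl mul1r !expRD -mulrA.
have Tk0 : 0 <= T `^ k1 by exact: powR_ge0.
apply: (@le_lt_trans _ _ (C * (expR z * expR (k * z)))).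
  by rewrite ler_pM2l //; nra.
by rewrite ltr_pM2r // mulr_gt0 // expR_gt0.
Qed.

(** Here [rho - 2 * c * t - t ^+ 2] is the cutoff [1 - |x + t e_i|^2], with [rho = 1 - |x|^2] and
    [c = x_i]; [b] stands for [a^-2]. *)
Lemma cutoff_second_test (U U1 : R -> R) (U2 rho c b M : R) :
  (forall t : R, is_derive t 1 U (U1 t)) -> is_derive (0 : R) 1 U1 U2 ->
  (exists2 del, 0 < del & forall t, `|t| < del ->
     (rho - 2 * c * t - t ^+ 2) * (b * U t - M) <= rho * (b * U 0 - M)) ->
  rho * (b * U1 0) = 2 * c * (b * U 0 - M) /\
  rho * (b * U2) <= 2 * (b * U 0 - M) + 4 * c * (b * U1 0).
Proof.
move=> dU dU1 [del del0 H].
pose g t := (rho - 2 * c * t - t ^+ 2) * (b * U t - M).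
pose g1 t := (- 2 * c - 2 * t) * (b * U t - M)
             + (rho - 2 * c * t - t ^+ 2) * (b * U1 t).
have dg (t : R) : is_derive t 1 g (g1 t).
  by apply: is_derive_eq; rewrite /g1 /GRing.scale /=; ring.
have dU0 := dU 0.
have dg1 : is_derive (0 : R) 1 g1
    (- 2 * (b * U 0 - M) - 4 * c * (b * U1 0) + rho * (b * U2)).
  by apply: is_derive_eq; rewrite /GRing.scale /=; ring.
have [|g10 g2] := second_derivative_test dg dg1.
  exists del => // t /H; rewrite /g expr2; lra.
rewrite /g1 in g10; split; lra.
Qed.

(** Time is parametrized by [a = (-t)^(-1/2)], so that the weight [e^(-la t)] becomes
    [expR (lam * a^-2)]. Only earlier times are compared, so the maximum may sit at the last time.
    For [U s = u (s *: x)] the right-hand side of the conclusion is [Phi u (a *: x)]. *)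
Lemma scaling_first_test (U : R -> R) (U1 lam rho M a : R) : 0 < rho -> 0 < a ->
  is_derive a 1 U U1 ->
  (exists2 del, 0 < del & forall t, 0 < t < del ->
     expR (lam * ((a - t)^-1) ^+ 2) * rho * (((a - t)^-1) ^+ 2 * U (a - t) - M)
     <= expR (lam * (a^-1) ^+ 2) * rho * ((a^-1) ^+ 2 * U a - M)) ->
  lam * ((a^-1) ^+ 2 * U a - M) <= 2^-1 * (a * U1) - U a.
Proof.
move=> rho0 a0 dU H.
have an0 : a != 0 by rewrite lt0r_neq0.
pose i (s : R) := (s^-1) ^+ 2.
have di : is_derive a 1 i (- 2 * (a^-1) ^+ 3).
  have dV : is_derive a 1 (fun s : R => s^-1) (- a ^- 2 *: 1).
    exact: is_deriveV an0 (is_derive_id a 1).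
  apply: is_derive_eq; rewrite /GRing.scale /=; field; exact: an0.
have de : is_derive a 1 (expR \o (fun s => lam * i s))
    (expR (lam * i a) * (lam * (- 2 * (a^-1) ^+ 3))).
  by apply: is_derive1_comp; apply: is_derive_eq.
pose g s := (expR \o (fun s => lam * i s)) s * rho * (i s * U s - M).
have dg : is_derive a 1 g (expR (lam * i a) * rho * 2 * (a^-1) ^+ 3 *
    (2^-1 * (a * U1) - U a - lam * (i a * U a - M))).
  apply: is_derive_eq; rewrite /GRing.scale /i /=; field; exact: an0.
have := derive_left_max dg H; rewrite pmulr_rge0 ?subr_ge0 //.
by rewrite !mulr_gt0 ?expR_gt0 ?exprn_gt0 ?invr_gt0.
Qed.

Lemma is_derive_sub_quadratic (U : R -> R) (U' N A B t : R) :
  is_derive t 1 U U' ->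
  is_derive t 1 (fun s => U s - N * (A + 2 * B * s + s ^+ 2))
    (U' - N * (2 * B + 2 * t)).
Proof. by move=> dU; apply: is_derive_eq; rewrite /GRing.scale /=; ring. Qed.

Lemma is_derive_sub_affine (U : R -> R) (U' N B t : R) : is_derive t 1 U U' ->
  is_derive t 1 (fun s => U s - N * (2 * B + 2 * s)) (U' - 2 * N).
Proof. by move=> dU; apply: is_derive_eq; rewrite /GRing.scale /=; ring. Qed.

End GrowthTools.

(** * Boundedness of the self-similar solution *)

Section ConvexGrowth.
Context {R : realType} {n : nat}.
Variables (u : 'rV[R]_n -> R).
Hypotheses (u_smooth : smooth u) (u_convex : strictly_convex u).
Implicit Types (x y p : 'rV[R]_n).

Lemma cball_max (f : 'rV[R]_n -> R) q r : continuous f -> 0 <= r ->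
  exists2 p, sq (p - q) <= r & forall x, sq (x - q) <= r -> f x <= f p.
Proof.
move=> cf r0; have cA := @compact_cball R n q r.
have [||c] := @compact_EVT_max _ _ f _ _ cA.
- by exists q; rewrite /cball /= subrr sq0.
- exact: continuous_subspaceT.
- by rewrite inE => cr H; exists c => // x xr; apply: H; rewrite inE.
Qed.

Lemma trace_hessian x : \tr (hessian u x) = \sum_i hess2 (delta_mx 0 i) u x.
Proof. by apply: eq_bigr => i _; rewrite mxE. Qed.

Lemma hess2_ge0 y x : 0 <= hess2 y u x.
Proof.
have [->|y0] := eqVneq y 0.
  by rewrite -hessian_form // !mul0mx mxE.
by rewrite -hessian_form //; apply: ltW; have [_] := u_convex x; exact.
Qed.

Lemma hess2Z (c : R) y x : hess2 (c *: y) u x = c ^+ 2 * hess2 y u x.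
Proof.
rewrite -!hessian_form // linearZ /= -!scalemxAl -scalemxAr scalerA.
by rewrite [in LHS]mxE expr2.
Qed.

Lemma trace_hessian_ge0 x : 0 <= \tr (hessian u x).
Proof. by rewrite trace_hessian sumr_ge0 // => i _; exact: hess2_ge0. Qed.

Lemma convex_tangent x y : u x + 'D_(y - x) u x <= u y.
Proof.
have d1 t := smooth_line x (y - x) t u_smooth.
have d2 t := smooth_line x (y - x) t (smooth_derive (y - x) u_smooth).
have := convex_above_tangent d1 d2 (fun t => hess2_ge0 (y - x) (x + t *: (y - x))) 0 1.
by rewrite !scale0r scale1r addr0 subr0 mulr1 [x + _]addrC subrK.
Qed.

(* Second-order conditions at a maximum of [(1 - |x|^2) (U - M)], where
   [U x = a^-2 u (a x)] is a time slice of the self-similar ancient solution. *)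
Lemma cutoff_trace_bound x (a M : R) : a != 0 -> sq x < 1 ->
  let z := (a^-1) ^+ 2 * u (a *: x) - M in
  (forall x', sq x' <= 1 ->
    (1 - sq x') * ((a^-1) ^+ 2 * u (a *: x') - M) <= (1 - sq x) * z) ->
  (1 - sq x) ^+ 2 * \tr (hessian u (a *: x)) <=
    2 * n%:R * ((1 - sq x) * z) + 8 * sq x * z.
Proof.
move=> a0 x1 z H; set rho := 1 - sq x.
have each i : rho ^+ 2 * hess2 (delta_mx 0 i) u (a *: x) <=
    2 * (rho * z) + 8 * (x 0 i * x 0 i) * z.
  pose e : 'rV[R]_n := delta_mx 0 i.
  have d1 t := smooth_line (a *: x) (a *: e) t u_smooth.
  have := smooth_line (a *: x) (a *: e) 0 (smooth_derive (a *: e) u_smooth).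
  rewrite -/(hess2 _ _ _) => d2.
  have [del del0 Hd] := near_line_lt e (@continuous_sq R n) x1.
  have sqE t : sq (x + t *: e) = sq x + 2 * x 0 i * t + t ^+ 2.
    by rewrite sqD dotZr sqZ sq_delta dot_delta; ring.
  have arg t : a *: x + t *: (a *: e) = a *: (x + t *: e).
    by rewrite scalerDr !scalerA mulrC.
  have [|E1 E2] := @cutoff_second_test R _ _ _ rho (x 0 i) ((a^-1) ^+ 2) M d1 d2.
    exists del => // t td; rewrite scale0r addr0 arg.
    have := H _ (ltW (Hd t td)); rewrite sqE; congr (_ * _ <= _).
    by rewrite /rho; ring.
  move: E1 E2; rewrite !scale0r !addr0 -/z -/e hess2Z.
  set p := (a^-1) ^+ 2 * 'D_(a *: e) u (a *: x); set h := hess2 e u _ => E1.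
  have -> : (a^-1) ^+ 2 * (a ^+ 2 * h) = h.
    by rewrite mulrA -exprMn mulVf // expr1n mul1r.
  have rho0 : 0 < rho by rewrite subr_gt0.
  (* Multiplying by [rho] once more lets the first-order condition [E1] eliminate the gradient term
     [p]. *)
  rewrite -(ler_pM2l rho0) => E2.
  have -> : rho ^+ 2 * h = rho * (rho * h) by ring.
  apply: (le_trans E2); rewrite le_eqVlt; apply/orP; left; apply/eqP.
  have -> : rho * (2 * z + 4 * x 0 i * p) = 2 * (rho * z) + 4 * x 0 i * (rho * p) by ring.
  by rewrite E1; ring.
rewrite trace_hessian mulr_sumr (le_trans (ler_sum _ (fun i _ => each i))) //.
rewrite big_split /= sumr_const card_ord -mulr_suml -mulr_sumr -/(dot x x) -/(sq x).
by rewrite lerD2r -mulr_natr le_eqVlt; apply/orP; left; apply/eqP; ring.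
Qed.

Variables (k1 C : R).
Hypotheses (k1_gt0 : 0 < k1) (C_gt0 : 0 < C).
Hypothesis growth : forall x,
  expR (Phi u x) <= C * ((\tr (hessian u x)) `^ k1 + 1).

(** The weighted function [H] is maximized over the unit ball times [[1, a0]]. A maximum above
    [expR lam] can lie neither on the lateral boundary, where the cutoff vanishes, nor at [a = 1],
    where [M] bounds [u]. Elsewhere the time test gives [Phi >= lam * z] and the space test a trace
    cubic in [z], contradicting (ii). The constant [lam] does not depend on [a0]. *)
Lemma self_similar_bound (M : R) : (forall x, sq x <= 1 -> u x <= M) ->
  exists lam : R, forall a x, 1 <= a -> sq x <= 1 ->
    (1 - sq x) * ((a^-1) ^+ 2 * u (a *: x) - M) <= expR lam.
Proof.
move=> HM.
have N0 : 0 < 2 * n%:R + 8 :> R by rewrite ltr_wpDl // mulr_ge0.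
(* The factor [2 * n + 8] and the exponent 3 are those of the trace bound [tz] below. *)
have [lam0 Hlam0] := exp_beats_power 3 C_gt0 k1_gt0 N0.
pose lam := Num.max lam0 0.
have lam_ge0 : 0 <= lam by rewrite le_max lexx orbT.
have Hlam z T : 1 <= z -> 0 <= T -> T <= (2 * n%:R + 8) * z ^+ 3 ->
    C * (T `^ k1 + 1) < expR (lam * z).
  move=> z1 T0 TN; apply: (lt_le_trans (Hlam0 z T z1 T0 TN)).
  rewrite ler_expR ler_wpM2r //; first by lra.
  by rewrite le_max lexx.
exists lam => a0 x0 a01 x01.
pose H (p : 'rV[R]_n * R) := expR (lam * (p.2^-1) ^+ 2) * (1 - sq p.1)
   * ((p.2^-1) ^+ 2 * u (p.2 *: p.1) - M).
pose K := (cball (0 : 'rV[R]_n) 1 `*` `[1, a0])%classic.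
have cK : compact K.
  by apply: compact_setX; [exact: compact_cball|exact: segment_compact].
have memK x a : K (x, a) <-> sq x <= 1 /\ 1 <= a <= a0.
  by rewrite /K /cball /= subr0 in_itv /=.
have cH : {within K, continuous H}%classic.
  apply: continuous_in_subspaceT => -[x a]; rewrite inE => /memK [_ /andP[a1 _]].
  have an0 : a != 0 by rewrite gt_eqF // (lt_le_trans ltr01).
  have c1 : {for (x, a), continuous (fun p : 'rV[R]_n * R => p.1)} by exact: cvg_fst.
  have c2 : {for (x, a), continuous (fun p : 'rV[R]_n * R => p.2)} by exact: cvg_snd.
  have c3 : {for (x, a), continuous (fun p : 'rV[R]_n * R => (p.2^-1) ^+ 2)}.
    by apply: continuousM; apply: cvgV.
  have c4 : {for (x, a), continuous (fun p : 'rV[R]_n * R => p.2 *: p.1)}.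
    exact: cvgZ.
  have c5 : {for (x, a), continuous (fun p : 'rV[R]_n * R => u (p.2 *: p.1))}.
    apply: (@continuous_comp _ _ _ (fun p : 'rV[R]_n * R => p.2 *: p.1) u _ c4).
    exact: (smooth_cont u_smooth).
  have c6 : {for (x, a), continuous (fun p : 'rV[R]_n * R => sq p.1)}.
    apply: (@continuous_comp _ _ _ (fun p : 'rV[R]_n * R => p.1) sq _ c1).
    exact: continuous_sq.
  have c7 : {for (x, a), continuous (fun p : 'rV[R]_n * R =>
      expR (lam * (p.2^-1) ^+ 2))}.
    apply: (@continuous_comp _ _ _ (fun p : 'rV[R]_n * R => lam * (p.2^-1) ^+ 2)).
      by apply: continuousM => //; exact: cst_continuous.
    exact: continuous_expR.
  have c8 := continuousB (@cst_continuous _ _ (1 : R) (x, a)) c6.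
  have c9 := continuousB (continuousM c3 c5) (@cst_continuous _ _ M (x, a)).
  exact: (continuousM (continuousM c7 c8) c9).
have [|[x a]] := compact_EVT_max _ cK cH.
  by exists (x0, a0); apply/memK; rewrite x01 a01 lexx.
rewrite inE => /memK [x1 /andP[a1 aa0]] Hmax.
have {}Hmax x' a' : sq x' <= 1 -> 1 <= a' <= a0 -> H (x', a') <= H (x, a).
  by move=> ? ?; apply: Hmax; rewrite inE; apply/memK.
have apos : 0 < a by apply: lt_le_trans a1.
have an0 : a != 0 by rewrite lt0r_neq0.
suff Hle : H (x, a) <= expR lam.
  have := le_trans (Hmax x0 a0 x01 _) Hle; rewrite a01 lexx => /(_ isT).
  rewrite /H /= -mulrA; set Q := (1 - sq x0) * _ => EQ.
  have [Q0|Q0] := leP Q 0; first exact: le_trans Q0 (expR_ge0 _).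
  apply: le_trans EQ; rewrite ler_peMl // ?(ltW Q0) //.
  by rewrite -expR0 ler_expR mulr_ge0 // sqr_ge0.
rewrite leNgt; apply/negP => W.
pose z := (a^-1) ^+ 2 * u (a *: x) - M; pose rho := 1 - sq x.
pose E := expR (lam * (a^-1) ^+ 2).
have E0 : 0 < E by exact: expR_gt0.
have rho0 : 0 <= rho by rewrite subr_ge0.
have rho1 : rho <= 1 by rewrite gerBl sq_ge0.
have WE : H (x, a) = E * rho * z by [].
have El : E <= expR lam.
  rewrite ler_expR -[leRHS]mulr1 ler_wpM2l // exprn_ile1 ?invr_ge0 ?(ltW apos) //.
  by rewrite invf_le1.
(* The weight [E] is at most [expR lam], so a value above [expR lam] forces the unweighted product
   above 1. *)
have rz : 1 < rho * z.
  rewrite -(ltr_pM2l E0) mulr1 mulrA -WE; exact: le_lt_trans W.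
have rhop : 0 < rho.
  rewrite lt_neqAle rho0 andbT; apply/eqP => r0.
  by move: rz; rewrite -r0 mul0r ltr10.
have z1 : 1 <= z by nra.
have x1' : sq x < 1 by rewrite -subr_gt0.
have aneq1 : 1 < a.
  rewrite lt_neqAle a1 andbT; apply/eqP => a1'.
  move: z1; rewrite /z -a1' invr1 expr1n mul1r scale1r.
  by have := HM _ x1; lra.
have tb : rho ^+ 2 * \tr (hessian u (a *: x)) <=
    2 * n%:R * (rho * z) + 8 * sq x * z.
  apply: cutoff_trace_bound => // x' x'1.
  have := Hmax x' a x'1; rewrite a1 aa0 => /(_ isT).
  by rewrite /H /= -!mulrA ler_pM2l.
have T0 := trace_hessian_ge0 (a *: x).
(* The bound [tb] degenerates as [rho] tends to 0; [rho * z > 1] trades the factor [rho ^+ 2] for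
   two more powers of [z]. *)
have tz : \tr (hessian u (a *: x)) <= (2 * n%:R + 8) * z ^+ 3.
  set T := \tr _ in tb T0 *.
  have tb' : rho ^+ 2 * T <= (2 * n%:R + 8) * z.
    apply: (le_trans tb); rewrite [leRHS]mulrDl; apply: lerD.
      by rewrite ler_wpM2l ?mulr_ge0 // ler_piMl //; lra.
    by rewrite -mulrA ler_pM2l // ler_piMl //; lra.
  apply: (@le_trans _ _ ((rho * z) ^+ 2 * T)).
    by rewrite ler_peMl // expr_ge1 //; lra.
  have -> : (rho * z) ^+ 2 * T = z ^+ 2 * (rho ^+ 2 * T) by ring.
  have -> : (2 * n%:R + 8) * z ^+ 3 = z ^+ 2 * ((2 * n%:R + 8) * z) by ring.
  by rewrite ler_wpM2l // sqr_ge0.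
have lz : lam * z <= Phi u (a *: x).
  have dU : is_derive a 1 (fun s : R => u (s *: x)) ('D_x u (a *: x)).
    have := smooth_line 0 x a u_smooth; rewrite add0r.
    by under eq_fun do rewrite add0r.
  rewrite /Phi deriveZr; last exact: smooth_diff.
  apply: (scaling_first_test rhop apos dU).
  exists (a - 1) => [|t /andP[t0 ta]]; first by rewrite subr_gt0.
  by apply: (Hmax x (a - t) x1); apply/andP; split; lra.
have := growth (a *: x); apply/negP; rewrite -ltNge.
apply: (lt_le_trans (Hlam z _ z1 T0 tz)).
by rewrite ler_expR.
Qed.

End ConvexGrowth.

(** * Quadratic growth of [u] and bounds on its derivatives *)

Section PhaseGrowth.
Context {R : realType} {n : nat}.
Variables (u : 'rV[R]_n -> R).
Hypotheses (u_smooth : smooth u) (u_convex : strictly_convex u).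
Implicit Types (x y p : 'rV[R]_n).

Lemma sq_add_le x y : sq (x + y) <= 2 * sq x + 2 * sq y.
Proof.
have := sq_ge0 (x - y); rewrite !sqD sqN -scaleN1r dotZr; lra.
Qed.

(** The oscillation bound forces the maximum of [u w - N * |w - z0|^2] into the open ball, and there
    every second derivative along a coordinate axis is at most [2 * N]. *)
Lemma trace_small_somewhere (z0 : 'rV[R]_n) (d N : R) : 0 < d ->
  (forall w, sq (w - z0) <= d -> u w - u z0 < N * d) ->
  exists2 w, sq (w - z0) <= d & \tr (hessian u w) <= 2 * n%:R * N.
Proof.
move=> d0 osc; pose g w := u w - N * sq (w - z0).
have cg : continuous g.
  move=> w; have c1 : {for w, continuous u} by exact: smooth_cont.
  have c2 : {for w, continuous (fun w : 'rV[R]_n => sq (w - z0))} by exact: continuous_sqB.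
  exact: (continuousB c1 (continuousM (@cst_continuous _ _ N w) c2)).
have [p pd Hp] := cball_max z0 cg (ltW d0).
exists p => //.
have pint : sq (p - z0) < d.
  rewrite lt_neqAle pd andbT; apply/eqP => pE.
  have := Hp z0; rewrite /g subrr sq0 pE mulr0 subr0 => /(_ (ltW d0)).
  have := osc p pd; lra.
rewrite trace_hessian.
have each i : hess2 (delta_mx 0 i) u p <= 2 * N.
  pose e : 'rV[R]_n := delta_mx 0 i.
  have [del del0 Hd] := near_line_lt e (@continuous_sqB R n z0) pint.
  have d1 t := smooth_line p e t u_smooth.
  have d2 := smooth_line p e 0 (smooth_derive e u_smooth).
  pose k t := u (p + t *: e) - N * (sq (p - z0) + 2 * (p - z0) 0 i * t + t ^+ 2).
  pose k1 t := 'D_e u (p + t *: e) - N * (2 * (p - z0) 0 i + 2 * t).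
  have kE t : k t = g (p + t *: e).
    rewrite /k /g; have -> : p + t *: e - z0 = (p - z0) + t *: e by rewrite addrAC.
    rewrite (sqD (p - z0)) dotZr sqZ sq_delta dot_delta; congr (_ - _ * _).
    by ring.
  have dk (t : R) : is_derive t 1 k (k1 t).
    exact: is_derive_sub_quadratic (d1 t).
  have dk1 : is_derive (0 : R) 1 k1 (hess2 e u (p + (0 : R) *: e) - 2 * N).
    exact: is_derive_sub_affine d2.
  rewrite scale0r addr0 in dk1.
  have [|_] := second_derivative_test dk dk1; last by rewrite subr_le0.
  exists del => // t td; rewrite !kE scale0r addr0; apply: Hp.
  by apply: ltW; exact: Hd.
apply: (le_trans (ler_sum _ (fun i _ => each i))).
rewrite sumr_const card_ord -mulr_natr; lra.
Qed.

Variables (k1 C : R).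
Hypotheses (k1_gt0 : 0 < k1) (C_gt0 : 0 < C).
Hypothesis growth : forall x,
  expR (Phi u x) <= C * ((\tr (hessian u x)) `^ k1 + 1).

(** The lower bound is the tangent plane at 0; the upper bound rescales [y] into the unit ball and
    applies [self_similar_bound]. *)
Lemma quadratic_bound : exists2 K : R, 0 < K & forall y, `|u y| <= K * (1 + sq y).
Proof.
have [q _ Hq] := cball_max 0 (smooth_cont u_smooth) ler01.
pose M := u q.
have HM x : sq x <= 1 -> u x <= M by move=> x1; apply: Hq; rewrite subr0.
have [lam Hlam] := self_similar_bound u_smooth u_convex k1_gt0 C_gt0 growth HM.
pose G := \sum_i `|partial i u 0|.
have G0 : 0 <= G by apply: sumr_ge0.
(* The first two terms come from [a ^+ 2 * (2 * expR lam + M)] with [a ^+ 2 <= 2 * (1 + sq y)], the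
   last two from the tangent plane at 0. *)
pose K := 4 * expR lam + 2 * `|M| + `|u 0| + G.
have E0 := expR_gt0 lam.
have M0 : M <= `|M| := ler_norm M. have M0' : 0 <= `|M| := normr_ge0 M.
have U0 : - u 0 <= `|u 0| by rewrite -normrN ler_norm. have U0' := normr_ge0 (u 0).
exists K => [|y]; first by rewrite /K; lra.
have s0 := sq_ge0 y.
rewrite ler_norml; apply/andP; split.
  have := convex_tangent u_smooth u_convex 0 y; rewrite subr0.
  have : - (G * (1 + sq y)) <= 'D_y u 0.
    rewrite derive_sum_partial; last exact: smooth_diff.
    rewrite mulr_suml -sumrN; apply: ler_sum => i _.
    have yi : `|y 0 i| <= 1 + sq y.
      apply: le_trans (normr_le_sq y); rewrite [leRHS]mx_normrE.
      by apply/bigmax_geP; right; exists (0, i).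
    rewrite lerNl -mulNr (le_trans (ler_norm _)) // normrM normrN mulrC.
    by rewrite ler_wpM2l.
  rewrite /K; nra.
(* With this scale [x = y / a] satisfies [sq x <= 1/2], so the cutoff is at least one half there. *)
pose a := Num.sqrt (2 * sq y + 1).
have a2 : a ^+ 2 = 2 * sq y + 1 by rewrite sqr_sqrtr //; lra.
have a0 : 0 < a by rewrite sqrtr_gt0; lra.
have a1 : 1 <= a.
  by rewrite -sqrtr1 ler_wsqrtr //; lra.
have an0 : a != 0 by rewrite lt0r_neq0.
pose x := a^-1 *: y.
have sx : sq x * a ^+ 2 = sq y.
  by rewrite /x sqZ mulrAC -exprMn mulVf // expr1n mul1r.
have xh : sq x <= 2^-1.
  by rewrite a2 in sx; have := sq_ge0 x; nra.
have := Hlam a x a1; rewrite /x scalerA divff // scale1r -/x => /(_ _).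
set z := _ - M => Hz.
have {}Hz : (1 - sq x) * z <= expR lam by apply: Hz; lra.
have zle : z <= 2 * expR lam.
  have [z0|z0] := leP z 0; first by lra.
  nra.
have -> : u y = a ^+ 2 * (z + M).
  by rewrite /z subrK mulrA -exprMn divff // expr1n mul1r.
rewrite a2 /K; nra.
Qed.

(** Rescaled to [sq h' <= s], the derivative is at most the increment [u (y + h') - u y] by
    convexity, and the quadratic bound gives at most [4 * K * s + K * s] for the two values. *)
Lemma gradient_bound (K : R) : 0 < K -> (forall y, `|u y| <= K * (1 + sq y)) ->
  forall y h s t, 0 <= t -> 1 + sq y <= s -> sq h <= t ^+ 2 * s ->
  'D_h u y <= 5 * K * t * s.
Proof.
move=> K0 HK y h s t; rewrite le_eqVlt => /orP[/eqP<-|t0] ys hs.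
  have -> : h = 0.
    by apply/eqP; apply: contraTT hs => /sq_gt0; rewrite expr0n mul0r -ltNge.
  by rewrite derive0 mulr0 mul0r.
pose h' := t^-1 *: h.
have hE : h = t *: h' by rewrite scalerA divff ?scale1r // lt0r_neq0.
have h's : sq h' <= s.
  rewrite /h' sqZ -(@ler_pM2l _ (t ^+ 2)) ?exprn_gt0 // mulrA -exprMn.
  by rewrite divff ?lt0r_neq0 // expr1n mul1r.
have D : 'D_h' u y <= 5 * K * s.
  have := convex_tangent u_smooth u_convex y (y + h').
  rewrite addrAC subrr add0r.
  have := HK y; have := HK (y + h'); rewrite !ler_norml => /andP[_ A] /andP[B _].
  have := sq_add_le y h'; have := sq_ge0 y; have := sq_ge0 h'.
  nra.
rewrite hE deriveZr; last exact: smooth_diff.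
have -> : 5 * K * t * s = t * (5 * K * s) by ring.
by rewrite ler_pM2l.
Qed.

End PhaseGrowth.

(** * Growth of [Phi] *)

Section PhaseMaximum.
Context {R : realType} {n : nat}.
Variables (u : 'rV[R]_n -> R).
Hypotheses (u_smooth : smooth u) (u_convex : strictly_convex u).
Implicit Types (x y p : 'rV[R]_n).
Variables (k1 C : R).
Hypotheses (k1_gt0 : 0 < k1) (C_gt0 : 0 < C).
Hypothesis growth : forall x,
  expR (Phi u x) <= C * ((\tr (hessian u x)) `^ k1 + 1).

(* Monotonicity of the gradient, applied in the direction [h], controls the
   variation of the radial derivative; [h] close to a small multiple of [x]
   makes the error small. *)
Lemma Phi_forward x (k h : 'rV[R]_n) (a : R) : 0 < a -> h = a *: x + k ->
  Phi u x - 2^-1 * (a * 'D_x u (x + h) + 'D_k u (x + h))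
    - (2 * a)^-1 * ('D_k u (x + h) - 'D_k u x) <= Phi u (x + h).
Proof.
move=> a0 hdef; set w := x + h.
have dw : differentiable u w by exact: smooth_diff.
have dx : differentiable u x by exact: smooth_diff.
have tw := convex_tangent u_smooth u_convex w x.
have tx := convex_tangent u_smooth u_convex x w.
have whE : x - w = -1 *: h by rewrite scaleN1r /w opprD addrA subrr sub0r.
have wxE : w - x = h by rewrite /w addrAC subrr add0r.
rewrite whE deriveZr // in tw; rewrite wxE in tx.
have hE z : differentiable u z -> 'D_h u z = a * 'D_x u z + 'D_k u z.
  by move=> dz; rewrite hdef derive_lin.
have wE : 'D_w u w = 'D_x u w + 'D_h u w by rewrite {1}/w deriveDr.
rewrite /Phi wE; rewrite !hE // in tw tx *.
move: ('D_x u w) ('D_k u w) ('D_x u x) ('D_k u x) (u x) (u w) tw tx.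
move=> Xw Kw Xx Kx ux uw tw tx.
have mono : 0 <= (Xw - Xx) + a^-1 * (Kw - Kx).
  rewrite -(pmulr_rge0 _ a0) mulrDr mulrA divff ?lt0r_neq0 // mul1r; lra.
have -> : (2 * a)^-1 * (Kw - Kx) = 2^-1 * (a^-1 * (Kw - Kx)).
  by rewrite invfM mulrA.
move: (a^-1 * (Kw - Kx)) mono => Q mono.
lra.
Qed.

(** With [sig] of order [|x|^(1/2)] this is weaker than a logarithmic bound, but it is still beaten
    by linear growth and avoids logarithms. *)
Lemma Phi_sublinear : exists2 lam : R, 0 <= lam &
  forall x sig, 1 <= sig -> 11 * (1 + sq x) <= sig ^+ 4 ->
    Phi u x <= 1 + lam * sig.
Proof.
have [K K0 HK] := quadratic_bound u_smooth u_convex k1_gt0 C_gt0 growth.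
have grad := gradient_bound u_smooth u_convex K0 HK.
pose L := 5 * K + 1.
have L1 : 1 <= L by rewrite /L; lra.
pose P := 2 * n%:R * (2 * K + 1) * (2 * L) ^+ 4 + 1.
have P0 : 0 < P.
  rewrite /P ltr_wpDl // !mulr_ge0 // ?exprn_ge0 //; lra.
(* The trace will be at most [P * s ^+ 5] with [s = sig ^+ 4]. *)
have [lam0 Hlam0] := exp_beats_power 20 C_gt0 k1_gt0 P0.
exists (Num.max lam0 0) => [|x sig sig1 hs]; first by rewrite le_max lexx orbT.
pose s := sig ^+ 4.
have x0 := sq_ge0 x.
have s1 : 1 <= s by rewrite /s expr_ge1 //; lra.
(* Each of the three derivative bounds in [Phi_forward] is [5 * K * (a * s)]; the total error is
   [10 * K * (a * s) <= 2 * L * (a * s) = 1]. *)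
pose a := (2 * L * s)^-1.
have Ls : 2 <= 2 * L * s by nra.
have a0 : 0 < a by rewrite invr_gt0; lra.
have aLs : a * (2 * L * s) = 1 by rewrite mulVf //; lra.
clearbody a.
have a1 : a <= 2^-1 by nra.
(* The ball has radius [a ^+ 2], which compensates the factor [(2 * a)^-1] in [Phi_forward]. *)
pose d := a ^+ 4.
have d0 : 0 < d by rewrite exprn_gt0.
have d1 : d <= 1 by rewrite exprn_ile1 ?ltW //; lra.
pose z0 := x + a *: x.
(* From [(1 + a) ^+ 2 <= 4] and [d <= 1] one gets [1 + sq w <= 8 * sq x + 3], which the factor 11
   absorbs. *)
have sz w : sq (w - z0) <= d -> 1 + sq w <= s.
  move=> wd; have -> : w = (1 + a) *: x + (w - z0).
    by rewrite scalerDl scale1r addrC subrK.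
  apply: le_trans hs; have := sq_add_le ((1 + a) *: x) (w - z0).
  have a4 : (1 + a) ^+ 2 * sq x <= 4 * sq x by rewrite ler_wpM2r //; nra.
  rewrite sqZ; lra.
have near_Phi w : sq (w - z0) <= d -> Phi u x - 1 <= Phi u w.
  move=> wd; pose k := w - z0.
  have wE : w = x + (a *: x + k) by rewrite addrA addrC subrK.
  have := Phi_forward a0 (erefl (a *: x + k)); rewrite -wE.
  have s_x : 1 + sq x <= s by apply: le_trans hs; lra.
  have kd : sq k <= (a ^+ 2) ^+ 2 * s.
    by rewrite -exprM (le_trans wd) // ler_peMr // ltW.
  have Nkd : sq (-1 *: k) <= (a ^+ 2) ^+ 2 * s by rewrite scaleN1r sqN.
  have a20 : 0 <= a ^+ 2 by rewrite exprn_ge0 // ltW.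
  have g1 := grad w x s 1 ler01 (sz w wd).
  have g2 := grad w k s _ a20 (sz w wd) kd.
  have g3 := grad x (-1 *: k) s _ a20 s_x Nkd.
  rewrite deriveZr in g3; last exact: smooth_diff.
  have {}g1 : 'D_x u w <= 5 * K * 1 * s.
    by apply: g1; rewrite expr1n mul1r; apply: le_trans hs; lra.
  move: ('D_x u w) ('D_k u w) ('D_k u x) (Phi u w) (Phi u x) g1 g2 g3.
  move=> X Kw Kx pw px g1 g2 g3 main.
  have as0 : 0 < a * s by rewrite mulr_gt0 //; lra.
  have inv : (2 * a)^-1 * (Kw - Kx) <= 5 * K * (a * s).
    rewrite mulrC ler_pdivrMr ?mulr_gt0 //.
    have -> : 5 * K * (a * s) * (2 * a) = 2 * (5 * K * a ^+ 2 * s) by ring.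
    lra.
  have aX : a * X <= 5 * K * (a * s).
    have -> : 5 * K * (a * s) = a * (5 * K * 1 * s) by ring.
    by rewrite ler_pM2l.
  have Kws : Kw <= 5 * K * (a * s).
    apply: (le_trans g2).
    have -> : 5 * K * a ^+ 2 * s = 5 * K * (a * s) * a by ring.
    have Kas0 : 0 <= 5 * K * (a * s) by rewrite mulr_ge0 ?(ltW as0) //; lra.
    by apply: ler_piMr => //; lra.
  have : 2 * L * (a * s) = 1 by apply: (etrans _ aLs); ring.
  rewrite /L; nra.
(* On the ball [|u| <= K * s]; the added 1 makes the inequality strict. *)
have osc w : sq (w - z0) <= d -> u w - u z0 < (2 * K * s + 1) / d * d.
  move=> wd; rewrite divfK ?lt0r_neq0 //.
  have z0d : sq (z0 - z0) <= d by rewrite subrr sq0 ltW.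
  have := HK w; have := HK z0; rewrite !ler_norml => /andP[A _] /andP[_ B].
  have := sz w wd; have := sz z0 z0d; nra.
have [w wd trw] := trace_small_somewhere u_smooth d0 osc.
have T0 := trace_hessian_ge0 u_smooth u_convex w.
have TP : \tr (hessian u w) <= P * sig ^+ 20.
  apply: (le_trans trw).
  have -> : sig ^+ 20 = s ^+ 5 by rewrite /s -exprM.
  have -> : d^-1 = (2 * L) ^+ 4 * s ^+ 4.
    apply: (mulfI (lt0r_neq0 d0)); rewrite divff ?lt0r_neq0 //.
    by rewrite -[X in _ * X]exprMn -exprMn aLs expr1n.
  have s5 : 0 <= s ^+ 5 by rewrite exprn_ge0 //; lra.
  apply: (@le_trans _ _ ((P - 1) * s ^+ 5)); last by rewrite ler_wpM2r //; lra.
  rewrite /P addrK.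
  have -> : 2 * n%:R * ((2 * K * s + 1) * ((2 * L) ^+ 4 * s ^+ 4)) =
    2 * n%:R * (2 * L) ^+ 4 * s ^+ 4 * (2 * K * s + 1) by ring.
  have -> : 2 * n%:R * (2 * K + 1) * (2 * L) ^+ 4 * s ^+ 5 =
    2 * n%:R * (2 * L) ^+ 4 * s ^+ 4 * ((2 * K + 1) * s) by ring.
  have n0 : 0 <= 2 * n%:R :> R by rewrite mulr_ge0.
  have L4 : 0 <= (2 * L) ^+ 4 by rewrite exprn_ge0 //; lra.
  have s4 : 0 <= s ^+ 4 by rewrite exprn_ge0 //; lra.
  apply: (ler_wpM2l (mulr_ge0 (mulr_ge0 n0 L4) s4)).
  nra.
have := Hlam0 sig _ sig1 T0 TP.
move=> /(le_lt_trans (growth w)); rewrite ltr_expR => Hw.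
have := near_Phi w wd.
have : lam0 * sig <= Num.max lam0 0 * sig by rewrite ler_wpM2r ?le_max ?lexx //; lra.
lra.
Qed.

End PhaseMaximum.

(** * Existence of a global maximum of [Phi] *)

Section LinearCombinations.
Context {R : realType}.

Lemma is_derive_sub_tangent (P U : R -> R) (P' U' eps a b c t : R) :
  is_derive t 1 P P' -> is_derive t 1 U U' ->
  is_derive t 1 (fun s => P s - eps * (U s - a - (b + s * c)))
    (P' - eps * (U' - c)).
Proof. by move=> dP dU; apply: is_derive_eq; rewrite /GRing.scale /=; ring. Qed.

Lemma is_derive_sub_cst (P U : R -> R) (P' U' eps c t : R) :
  is_derive t 1 P P' -> is_derive t 1 U U' ->
  is_derive t 1 (fun s => P s - eps * (U s - c)) (P' - eps * U').
Proof. by move=> dP dU; apply: is_derive_eq; rewrite /GRing.scale /=; ring. Qed.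

End LinearCombinations.

Section GlobalMaximum.
Context {R : realType} {n : nat}.
Variables (u : 'rV[R]_n -> R).
Hypotheses (u_smooth : smooth u) (u_convex : strictly_convex u).
Implicit Types (x y p e : 'rV[R]_n).

(** The function [v] of the outline: [u] minus its tangent plane at the origin. *)
Definition bregman0 x := u x - u 0 - 'D_x u 0.

Lemma bregman0_0 : bregman0 0 = 0.
Proof. by rewrite /bregman0 derive0 subrr subr0. Qed.

Lemma bregman0_ge0 x : 0 <= bregman0 x.
Proof.
have := convex_tangent u_smooth u_convex 0 x; rewrite subr0 /bregman0; lra.
Qed.

(** The right-hand side is the radial derivative of [bregman0], which the first-order condition at a
    penalized maximum controls. *)
Lemma bregman0_le x : bregman0 x <= 'D_x u x - 'D_x u 0.
Proof.
have := convex_tangent u_smooth u_convex x 0; rewrite sub0r -scaleN1r deriveZr.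
  by rewrite /bregman0; lra.
exact: smooth_diff.
Qed.

Lemma bregman0_gt0 x : x != 0 -> 0 < bregman0 x.
Proof.
move=> x0.
have hpos z : 0 < hess2 x u z.
  by rewrite -hessian_form //; have [_] := u_convex z; exact.
have d1 t := smooth_line 0 x t u_smooth.
have d2 t := smooth_line 0 x t (smooth_derive x u_smooth).
have [c /andP[c0 _]] := mvt d1 ltr01.
have [c' _] := mvt d2 c0.
rewrite !scale0r !add0r scale1r !subr0 mulr1 -/(hess2 x u (c' *: x)) => E2 E1.
rewrite /bregman0 E1 E2; apply: mulr_gt0 => //; exact: hpos.
Qed.

Lemma bregman0_ray e (t : R) : 1 <= t -> t * bregman0 e <= bregman0 (t *: e).
Proof.
move=> t1; have de z : differentiable u z by exact: smooth_diff.
have h1 := convex_tangent u_smooth u_convex e (t *: e).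
have h2 := convex_tangent u_smooth u_convex e 0.
have E1 : t *: e - e = (t - 1) *: e by rewrite scalerBl scale1r.
rewrite E1 deriveZr // in h1; rewrite sub0r -scaleN1r deriveZr // in h2.
rewrite /bregman0 deriveZr //.
move: (u _) (u e) (u 0) ('D_e u e) ('D_e u 0) h1 h2 => a b c d f h1 h2.
nra.
Qed.

Lemma continuous_bregman0 : continuous bregman0.
Proof.
have c1 : continuous (fun x => \sum_i x 0 i * partial i u 0).
  apply: continuous_sumr => i x.
  have c1 : {for x, continuous (fun x : 'rV[R]_n => x 0 i)} by exact: coord_continuous.
  exact: (continuousM c1 (@cst_continuous _ _ (partial i u 0) x)).
have -> : bregman0 = (fun x => u x - u 0 - \sum_i x 0 i * partial i u 0).
  apply/funext => x; rewrite /bregman0 derive_sum_partial //; exact: smooth_diff.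
move=> x; have c2 : {for x, continuous u} by exact: smooth_cont.
exact: (continuousB (continuousB c2 (@cst_continuous _ _ (u 0) x)) (c1 x)).
Qed.

Lemma continuous_Phi : continuous (Phi u).
Proof.
have c1 : continuous (fun x => \sum_i x 0 i * partial i u x).
  apply: continuous_sumr => i x.
  have c1 : {for x, continuous (fun x : 'rV[R]_n => x 0 i)} by exact: coord_continuous.
  have c2 : {for x, continuous (partial i u)}.
    exact: (smooth_cont (smooth_derive (delta_mx 0 i) u_smooth)).
  exact: (continuousM c1 c2).
have -> : Phi u = (fun x => 2^-1 * (\sum_i x 0 i * partial i u x) - u x).
  apply/funext => x; rewrite /Phi derive_sum_partial //; exact: smooth_diff.
move=> x; have c2 : {for x, continuous u} by exact: smooth_cont.
exact: (continuousB (continuousM (@cst_continuous _ _ (2^-1 : R) x) (c1 x)) c2).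
Qed.

(** The constant is the minimum over the unit sphere, propagated along rays by [bregman0_ray]. *)
Lemma bregman0_coercive : exists2 c : R, 0 < c &
  forall x (r : R), 1 <= r -> r ^+ 2 <= sq x -> c * r <= bregman0 x.
Proof.
pose S := [set x : 'rV[R]_n | sq x = 1]%classic.
have [S0|S0] := pselect (S !=set0)%classic; last first.
  (* If the sphere is empty no such [x] exists, since normalizing it would give a point of the
     sphere. *)
  exists 1 => // x r r1 rx; exfalso; apply: S0.
  have x0 : 0 < sq x by apply: lt_le_trans rx; rewrite exprn_gt0 //; lra.
  exists ((Num.sqrt (sq x))^-1 *: x).
  rewrite /S /= sqZ exprVn sqr_sqrtr ?(ltW x0) //.
  by rewrite mulVf ?lt0r_neq0 //.
have cS : compact S.
  apply: (subclosed_compact _ (@compact_cball R n 0 1)).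
    rewrite (_ : S = sq @^-1` [set 1 : R])%classic; last by [].
    apply: preimage_closed; first by move=> x _; exact: continuous_sq.
    exact: closed_eq.
  by move=> x /= x1; rewrite /cball /= subr0 x1.
have [e eS He] := compact_EVT_min S0 cS (continuous_subspaceT continuous_bregman0).
have e1 : sq e = 1 by move: eS; rewrite inE.
have e0 : e != 0 by apply/eqP => e0; move: e1; rewrite e0 sq0 => /esym/eqP; rewrite oner_eq0.
exists (bregman0 e) => [|x r r1 rx]; first exact: bregman0_gt0.
have x0 : 0 < sq x by apply: lt_le_trans rx; rewrite exprn_gt0 //; lra.
pose s := Num.sqrt (sq x).
have s2 : s ^+ 2 = sq x by rewrite sqr_sqrtr // ltW.
have sr : r <= s.
  by rewrite -(@ler_pXn2r _ 2) // ?nnegrE ?sqrtr_ge0 ?s2 //; lra.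
have s0 : s != 0 by rewrite gt_eqF //; lra.
have fS : s^-1 *: x \in S by rewrite inE /S /= sqZ exprVn s2 mulVf // lt0r_neq0.
have -> : x = s *: (s^-1 *: x) by rewrite scalerA divff // scale1r.
apply: le_trans (bregman0_ray _ _); last by lra.
have := He _ fS; have := bregman0_gt0 e0; nra.
Qed.

Variables (k1 C B : R).
Hypotheses (k1_gt0 : 0 < k1) (C_gt0 : 0 < C).
Hypothesis growth : forall x,
  expR (Phi u x) <= C * ((\tr (hessian u x)) `^ k1 + 1).
Hypothesis linearized : forall x, exists s : seq 'rV[R]_n,
  dPhi u x x 0 = 2 * \sum_(y <- s) ddPhi u x y 0 /\ \sum_(y <- s) hess2 y u x <= B.

(** The maximum exists because [Phi] grows like [|x|^(1/2)] at most and [bregman0] at least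
    linearly. At [p] the linearized equation gives [eps * 'D_p v <= 2 * eps * B]; dividing by [eps]
    leaves a bound independent of [eps]. *)
Lemma Phi_minus_bregman0_max (eps : R) : 0 < eps ->
  exists2 p, bregman0 p <= 2 * B &
    forall x, Phi u x - eps * bregman0 x <= Phi u p - eps * bregman0 p.
Proof.
move=> eps0; pose psi x := Phi u x - eps * bregman0 x.
have cpsi : continuous psi.
  move=> x; exact: (continuousB (@continuous_Phi x)
    (continuousM (@cst_continuous _ _ eps x) (@continuous_bregman0 x))).
have [lam lam0 Hlam] := Phi_sublinear u_smooth u_convex k1_gt0 C_gt0 growth.
have [c c0 Hc] := bregman0_coercive.
pose A := 3 * lam + `|1 - Phi u 0|.
have A0 : 0 <= A by rewrite addr_ge0 // mulr_ge0.
(* For [q = |x|^(1/2) >= tau] the penalty, at least [eps * c * q ^+ 2], exceeds [A * q], which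
   bounds [Phi u x - Phi u 0]. *)
pose tau := 1 + A / (eps * c).
have ec0 : 0 < eps * c by rewrite mulr_gt0.
have tau1 : 1 <= tau by rewrite lerDl divr_ge0 // ltW.
have tauA : A <= eps * c * tau.
  rewrite /tau mulrDr mulr1 [X in _ + X]mulrC divfK ?lt0r_neq0 //; lra.
have tau40 : 0 <= tau ^+ 4 by rewrite exprn_ge0 //; lra.
have [p0 _ Hp0] := cball_max 0 cpsi tau40.
have far x : tau ^+ 4 < sq x -> psi x <= psi 0.
  move=> xt; have x0 := sq_ge0 x.
  pose r := Num.sqrt (sq x); have r2 : r ^+ 2 = sq x by rewrite sqr_sqrtr.
  pose q := Num.sqrt r; have q2 : q ^+ 2 = r by rewrite sqr_sqrtr // sqrtr_ge0.
  have q0 : 0 <= q by exact: sqrtr_ge0.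
  have q4 : q ^+ 4 = sq x by rewrite -r2 -q2 -exprM.
  have tq : tau <= q.
    by rewrite -(@ler_pXn2r _ 4) // ?nnegrE ?q4 ?ltW //; lra.
  have q1 : 1 <= q by lra.
  have q41 : 1 <= q ^+ 4 by rewrite expr_ge1.
  (* The choice [sig = 3 * q] is admissible: [11 * (1 + q ^+ 4) <= 22 * q ^+ 4 <= 81 * q ^+ 4]. *)
  have h1 : Phi u x <= 1 + lam * (3 * q).
    by apply: Hlam; rewrite ?exprMn -?q4; nra.
  have h2 : c * r <= bregman0 x by apply: Hc; rewrite ?r2 // -q2 expr_ge1.
  have h3 : 1 - Phi u 0 <= `|1 - Phi u 0| by exact: ler_norm.
  have h4 : A * q <= eps * c * q ^+ 2.
    rewrite expr2 mulrA ler_wpM2r // (le_trans tauA) // ler_pM2l //.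
  have h5 : `|1 - Phi u 0| <= `|1 - Phi u 0| * q by rewrite ler_peMr.
  rewrite /psi bregman0_0 mulr0 subr0.
  have h6 : eps * (c * r) <= eps * bregman0 x by rewrite ler_pM2l.
  rewrite q2 in h4; rewrite /A in h4; nra.
have {Hp0} [p Hp] : exists p, forall x, psi x <= psi p.
  exists p0 => x; have [xt|xt] := leP (sq x) (tau ^+ 4).
    by apply: Hp0; rewrite subr0.
  apply: (le_trans (far x xt)); apply: Hp0; by rewrite subr0 sq0.
exists p => //.
have test y : dPhi u p y 0 = eps * ('D_y u p - 'D_y u 0) /\
              ddPhi u p y 0 <= eps * hess2 y u p.
  pose g t := Phi u (p + t *: y)
    - eps * (u (p + t *: y) - u 0 - ('D_p u 0 + t * 'D_y u 0)).
  pose g1 t := dPhi u p y t - eps * ('D_y u (p + t *: y) - 'D_y u 0).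
  have gE t : g t = psi (p + t *: y).
    rewrite /g /psi /bregman0; congr (_ - eps * (_ - _)).
    by rewrite deriveDr ?deriveZr //; exact: smooth_diff.
  have dg (t : R) : is_derive t 1 g (g1 t).
    exact: is_derive_sub_tangent (is_derive_Phi p y t u_smooth)
      (smooth_line p y t u_smooth).
  have dg1 : is_derive (0 : R) 1 g1
      (ddPhi u p y 0 - eps * hess2 y u (p + (0 : R) *: y)).
    exact: is_derive_sub_cst (is_derive_dPhi p y 0 u_smooth)
      (smooth_line p y 0 (smooth_derive y u_smooth)).
  have [|E1 E2] := second_derivative_test dg dg1.
    by exists 1 => // t _; rewrite !gE scale0r addr0; exact: Hp.
  by move: E1 E2; rewrite /g1 scale0r addr0 subr_le0 => /eqP; rewrite subr_eq0 => /eqP.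
have [s [E1 E2]] := linearized p.
have : dPhi u p p 0 <= 2 * (eps * B).
  rewrite E1 ler_pM2l //; apply: le_trans (_ : eps * \sum_(y <- s) hess2 y u p <= _).
    by rewrite mulr_sumr ler_sum // => y _; have [] := test y.
  by rewrite ler_pM2l.
have [-> _] := test p; have := bregman0_le p; nra.
Qed.

(** All penalized maxima lie in one ball, so the maximum [q] over that ball dominates
    [Phi u x - eps * bregman0 x] for every [eps]; then [eps] tends to 0 with [x] fixed. *)
Lemma Phi_attains_max : exists q, forall x, Phi u x <= Phi u q.
Proof.
have [c c0 Hc] := bregman0_coercive.
(* This instance only serves to show [0 <= 2 * B]. *)
have [p0 B0 _] := Phi_minus_bregman0_max ltr01.
pose r := 1 + 2 * B / c.
have B2 : 0 <= 2 * B / c.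
  exact: divr_ge0 (le_trans (bregman0_ge0 p0) B0) (ltW c0).
have [q _ Hq] := cball_max 0 continuous_Phi (exprn_ge0 2 (addr_ge0 ler01 B2)).
exists q => x; apply/ler_addgt0Pr => e e0.
have v0 := bregman0_ge0 x.
pose eps := e / (bregman0 x + 1).
have eps0 : 0 < eps by rewrite divr_gt0 //; lra.
have epsv : eps * bregman0 x <= e.
  rewrite /eps mulrAC ler_pdivrMr; last by lra.
  by rewrite ler_pM2l //; lra.
have [p pB Hp] := Phi_minus_bregman0_max eps0.
have pq : Phi u p <= Phi u q.
  apply: Hq; rewrite subr0 leNgt; apply/negP => pr.
  have r1 : 1 <= r by rewrite lerDl.
  have := Hc p r r1 (ltW pr); apply/negP; rewrite -ltNge (le_lt_trans pB) //.
  by rewrite /r mulrDr mulr1 [c * (_ / _)]mulrC divfK ?lt0r_neq0 // ltrDr.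
have := Hp x; have := bregman0_ge0 p; nra.
Qed.

End GlobalMaximum.

(** * Gaussian barrier along lines *)

Section GaussianBarrier.
Context {R : realType}.
Variables (al s b k : R).

(** The restriction of [expR (- al * |z|^2)] to a line [w + t y], with [s = |w|^2], [b] the product
    of [w] and [y], and [k = |y|^2]. *)
Let G (t : R) : R := expR (- al * (s + 2 * b * t + k * t ^+ 2)).

Lemma is_derive_gaussian (t : R) :
  is_derive t 1 G (- al * (2 * b + 2 * k * t) * G t).
Proof.
have dp : is_derive t 1 (fun t => - al * (s + 2 * b * t + k * t ^+ 2))
    (- al * (2 * b + 2 * k * t)).
  by apply: is_derive_eq; rewrite /GRing.scale /=; ring.
apply: (is_derive_eq (is_derive1_comp (is_derive_expR _) dp)).
exact: mulrC.
Qed.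

Lemma is_derive_gaussian' :
  is_derive (0 : R) 1 (fun t => - al * (2 * b + 2 * k * t) * G t)
    ((4 * al ^+ 2 * b ^+ 2 - 2 * al * k) * G 0).
Proof.
have dG := is_derive_gaussian 0.
by apply: is_derive_eq; rewrite /GRing.scale /=; ring.
Qed.

Lemma gaussian_second_test (P P1 : R -> R) (P2 eps kap : R) :
  (forall t : R, is_derive t 1 P (P1 t)) -> is_derive (0 : R) 1 P1 P2 ->
  (exists2 del, 0 < del & forall t, `|t| < del ->
     P t + eps * (G t - kap) <= P 0 + eps * (G 0 - kap)) ->
  P1 0 = eps * (2 * al * b) * G 0 /\
  P2 <= - eps * (4 * al ^+ 2 * b ^+ 2 - 2 * al * k) * G 0.
Proof.
move=> dP dP1 H.
have d1 (t : R) : is_derive t 1 (fun t => P t + eps * (G t - kap))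
    (P1 t + eps * (- al * (2 * b + 2 * k * t) * G t)).
  have dG := is_derive_gaussian t; have dPt := dP t.
  by apply: is_derive_eq; rewrite /GRing.scale /=; ring.
have d2 : is_derive (0 : R) 1
    (fun t => P1 t + eps * (- al * (2 * b + 2 * k * t) * G t))
    (P2 + eps * ((4 * al ^+ 2 * b ^+ 2 - 2 * al * k) * G 0)).
  have dG := is_derive_gaussian'.
  by apply: is_derive_eq; rewrite /GRing.scale /=; ring.
have [E1 E2] := second_derivative_test d1 d2 H.
by split; lra.
Qed.

End GaussianBarrier.

(** * Continuity of matrix-valued functions *)

Section MatrixContinuity.
Context {R : realType} {n : nat}.

Lemma continuous_mx (M : 'rV[R]_n -> 'M[R]_n) :
  (forall i j, continuous (fun x => M x i j)) -> continuous M.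
Proof.
move=> cM x; have FF : Filter (nbhs x) by exact: nbhs_filter.
apply/(@cvgrPdist_le _ _ _ (nbhs x) FF) => e e0.
have H : \forall y \near x, forall i : 'I_n * 'I_n,
    `|M x i.1 i.2 - M y i.1 i.2| <= e.
  apply: (@filter_forall _ _ _ _ FF) => i.
  exact: (cvgrPdist_le _ _).1 (cM i.1 i.2 x) e e0.
apply: (@filterS _ _ FF _ _ _ H) => y Hy.
rewrite [leLHS]/Num.Def.normr /= mx_normrE (bigmax_le _ (ltW e0)) // => i _.
by rewrite !mxE; exact: Hy.
Qed.

(** [DF] is continuous relative to the cone only, but the Hessian never leaves the cone. *)
Lemma continuous_within_comp (S : set 'M[R]_n) (f : 'M[R]_n -> 'M[R]_n)
    (h : 'rV[R]_n -> 'M[R]_n) :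
  {within S, continuous f}%classic -> continuous h -> (forall x, S (h x)) ->
  continuous (fun x => f (h x)).
Proof.
move=> /subspace_continuousP cf ch hS x.
apply: (@cvg_comp _ _ _ h f _ (within S (nbhs (h x)))); last exact: cf.
move=> P wP; apply: (@filterS _ _ (nbhs_filter x) _ _ _ (ch x _ wP)) => y.
by apply; exact: hS.
Qed.

Lemma continuous_hessian (u : 'rV[R]_n -> R) : smooth u -> continuous (hessian u).
Proof.
move=> su; apply: continuous_mx => i j.
have -> : (fun x => hessian u x i j) = partial i (partial j u).
  by apply/funext => x; rewrite mxE.
exact: (smooth_cont (smooth_derive (delta_mx 0 i) (smooth_derive (delta_mx 0 j) su))).
Qed.

Lemma continuous_mxtrace (A : 'rV[R]_n -> 'M[R]_n) :
  continuous A -> continuous (fun x => \tr (A x)).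
Proof.
move=> cA; apply: continuous_sumr => i x.
exact: (@continuous_comp _ _ _ A (fun M : 'M[R]_n => M i i) x (cA x)
  (@coord_continuous _ _ _ i i (A x))).
Qed.

Lemma continuous_mulmx (A B : 'rV[R]_n -> 'M[R]_n) :
  continuous A -> continuous B -> continuous (fun x => A x *m B x).
Proof.
move=> cA cB; apply: continuous_mx => i j.
have -> : (fun x => (A x *m B x) i j) = (fun x => \sum_l A x i l * B x l j).
  by apply/funext => x; rewrite mxE.
apply: continuous_sumr => l x.
have c1 : {for x, continuous (fun x => A x i l)}.
  exact: (@continuous_comp _ _ _ A (fun M : 'M[R]_n => M i l) x (cA x)
    (@coord_continuous _ _ _ i l (A x))).
have c2 : {for x, continuous (fun x => B x l j)}.
  exact: (@continuous_comp _ _ _ B (fun M : 'M[R]_n => M l j) x (cB x)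
    (@coord_continuous _ _ _ l j (B x))).
exact: (continuousM c1 c2).
Qed.

Lemma continuous_outer (c : 'rV[R]_n) :
  continuous (fun x : 'rV[R]_n => (x - c)^T *m (x - c)).
Proof.
apply: continuous_mx => i j.
have -> : (fun x : 'rV[R]_n => ((x - c)^T *m (x - c)) i j)
    = (fun x => (x 0 i - c 0 i) * (x 0 j - c 0 j)).
  by apply/funext => x; rewrite mxE big_ord1 !mxE.
move=> x.
have cc l : {for x, continuous (fun x : 'rV[R]_n => x 0 l - c 0 l)}.
  have cl : {for x, continuous (fun x : 'rV[R]_n => x 0 l)} by exact: coord_continuous.
  exact: (continuousB cl (@cst_continuous _ _ (c 0 l) x)).
exact: (continuousM (cc i) (cc j)).
Qed.

Lemma tr_outer (A : 'M[R]_n) (w : 'rV[R]_n) :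
  \tr (A *m (w^T *m w)) = (w *m A *m w^T) 0 0.
Proof. by rewrite mulmxA mxtrace_mulC mulmxA [LHS]big_ord1. Qed.

End MatrixContinuity.

(** * Strong maximum principle *)

Section StrongMaximumPrinciple.
Context {R : realType} {n : nat}.
Variables (u : 'rV[R]_n -> R) (A : 'rV[R]_n -> 'M[R]_n).
Hypotheses (u_smooth : smooth u) (A_cont : continuous A).
Hypothesis A_posdef : forall x, posdef_mx (A x).
Hypothesis linearized : forall x, exists s : seq 'rV[R]_n,
  A x = \sum_(y <- s) y^T *m y /\ dPhi u x x 0 = 2 * \sum_(y <- s) ddPhi u x y 0.
Implicit Types (x y p q c : 'rV[R]_n).

Lemma tr_sum_dot (s : seq 'rV[R]_n) (w : 'rV[R]_n) :
  \tr ((\sum_(y <- s) y^T *m y) *m (w^T *m w)) = \sum_(y <- s) dot w y ^+ 2.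
Proof.
rewrite tr_rank_one_sum; apply: eq_bigr => y _.
rewrite mulmxA -mulmxA mxE big_ord1 !mxE expr2 dotC; congr (_ * _).
  by apply: eq_bigr => i _; rewrite !mxE.
by rewrite dotC; apply: eq_bigr => i _; rewrite !mxE.
Qed.

Lemma tr_sum_sq (s : seq 'rV[R]_n) :
  \tr (\sum_(y <- s) y^T *m y) = \sum_(y <- s) sq y.
Proof.
rewrite -[X in \tr X]mulmx1 tr_rank_one_sum; apply: eq_bigr => y _.
by rewrite mulmx1 mxE; apply: eq_bigr => i _; rewrite !mxE.
Qed.

Lemma continuous_dotB c : continuous (fun x => dot (x - c) x).
Proof.
apply: continuous_sumr => i x.
have c1 : {for x, continuous (fun x : 'rV[R]_n => x 0 i)} by exact: coord_continuous.
have E : (fun x => (x - c) 0 i * x 0 i) = (fun x => (x 0 i - c 0 i) * x 0 i).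
  by apply/funext => z; rewrite !mxE.
rewrite E.
exact: (continuousM (continuousB c1 (@cst_continuous _ _ (c 0 i) x)) c1).
Qed.

(** The first and second derivative tests are inserted into the linearized equation and divided by
    [2 * eps * al * G0]. Where [x != c] the conclusion fails for large [al], which excludes interior
    maxima. *)
Lemma interior_gaussian_test x c (al eps kap : R) : 0 < al -> 0 < eps ->
  (forall y, exists2 del : R, 0 < del & forall t : R, `|t| < del ->
     Phi u (x + t *: y) + eps * (expR (- al * sq (x + t *: y - c)) - kap) <=
     Phi u x + eps * (expR (- al * sq (x - c)) - kap)) ->
  4 * al * \tr (A x *m ((x - c)^T *m (x - c))) <= 2 * \tr (A x) - dot (x - c) x.
Proof.
move=> al0 eps0 H; set w := x - c.
have sqE y t : sq (x + t *: y - c) = sq w + 2 * dot w y * t + sq y * t ^+ 2.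
  have -> : x + t *: y - c = w + t *: y by rewrite addrAC.
  by rewrite sqD dotZr sqZ; ring.
pose G0 := expR (- al * sq w); have G00 : 0 < G0 by exact: expR_gt0.
have test y : dPhi u x y 0 = eps * (2 * al * dot w y) * G0 /\
    ddPhi u x y 0 <= - eps * (4 * al ^+ 2 * dot w y ^+ 2 - 2 * al * sq y) * G0.
  have dP t := is_derive_Phi x y t u_smooth.
  have dP1 := is_derive_dPhi x y 0 u_smooth.
  have [|] := @gaussian_second_test R al (sq w) (dot w y) (sq y) _ _ _ eps kap dP dP1.
    have [del del0 Hd] := H y; exists del => // t td.
    have := Hd t td; rewrite sqE scale0r addr0.
    by rewrite mulr0 expr0n mulr0 !addr0.
  by rewrite mulr0 expr0n mulr0 !addr0.
have [s [AE E]] := linearized x.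
rewrite AE tr_sum_dot tr_sum_sq.
have [E1 _] := test x; rewrite E1 in E.
have : \sum_(y <- s) ddPhi u x y 0 <=
    \sum_(y <- s) - eps * (4 * al ^+ 2 * dot w y ^+ 2 - 2 * al * sq y) * G0.
  by apply: ler_sum => y _; have [] := test y.
have -> : \sum_(y <- s) - eps * (4 * al ^+ 2 * dot w y ^+ 2 - 2 * al * sq y) * G0 =
  - eps * (4 * al ^+ 2 * (\sum_(y <- s) dot w y ^+ 2)
           - 2 * al * (\sum_(y <- s) sq y)) * G0.
  by rewrite -mulr_suml -mulr_sumr sumrB -!mulr_sumr.
move: (\sum_(y <- s) ddPhi u x y 0) (\sum_(y <- s) dot w y ^+ 2)
  (\sum_(y <- s) sq y) (dot w x) E => S D Q d E SD.
have pos : 0 < 2 * eps * al * G0 by rewrite !mulr_gt0.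
rewrite -(ler_pM2l pos); nra.
Qed.

(** Hopf's argument: a ball whose closed hull meets the maximum set only at [p] carries a Gaussian
    barrier, which pushes maxima of the perturbed function near [p] to a compact set where
    [Phi < m]. *)
Lemma Phi_strong_maximum q : (forall x, Phi u x <= Phi u q) ->
  forall x, Phi u x = Phi u q.
Proof.
move=> Hq q0; have cPhi := continuous_Phi u_smooth.
set m := Phi u q; apply/eqP/negP => q0m.
pose Z := (cball q0 (sq (q - q0)) `&` (Phi u @^-1` [set m]))%classic.
have clZ : closed (Phi u @^-1` [set m])%classic.
  by apply: preimage_closed; [move=> x _; exact: cPhi|exact: closed_eq].
have cZ : compact Z.
  by rewrite /Z; apply: compact_closedI; [exact: compact_cball|].
have Zq : Z q by split; rewrite /cball /=.
have [p pZ Hp] := compact_EVT_min (ex_intro _ q Zq) cZ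
   (continuous_subspaceT (@continuous_sqB R n q0)).
have [pq pm] : sq (p - q0) <= sq (q - q0) /\ Phi u p = m.
  by move: pZ; rewrite inE => -[].
have inside x : sq (x - q0) < sq (p - q0) -> Phi u x < m.
  move=> xp; rewrite lt_neqAle Hq andbT; apply/eqP => xm.
  have := Hp x; rewrite inE leNgt xp => /(_ _)/negP; apply; last by [].
  by split => //; apply: ltW; apply: lt_le_trans pq.
have pq0 : p != q0 by apply/eqP => E; apply: q0m; rewrite -E pm.
(* Here [p] is a point of the maximum set nearest to [q0]. Halving the ball about [q0] that touches
   at [p] leaves [p] as the only contact point. *)
pose eta := 2^-1 *: (p - q0); pose c := q0 + eta.
have pc : p - c = eta.
  rewrite /c opprD addrA -[X in X - _](scale1r (p - q0)) /eta -scalerBl.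
  by congr (_ *: _); lra.
have eta0 : 0 < sq eta.
  by rewrite /eta sqZ mulr_gt0 ?exprn_gt0 ?invr_gt0 // sq_gt0 // subr_eq0.
have petaE : sq (p - q0) = 4 * sq eta.
  by rewrite /eta sqZ mulrA -{1}[sq _]mul1r; congr (_ * _); field.
pose r := sq eta.
have touch x : sq (x - c) <= r -> x != p -> Phi u x < m.
  move=> xr xp; apply: inside.
  have xp0 : 0 < sq (x - p) by rewrite sq_gt0 // subr_eq0.
  have E1 : x - q0 = (x - c) + eta by rewrite /c opprD addrA subrK.
  have E2 : x - p = (x - c) + - eta by rewrite -pc opprB addrA subrK.
  have dN : dot (x - c) (- eta) = - dot (x - c) eta by rewrite -(scaleN1r eta) dotZr mulN1r.
  move: xp0; rewrite E1 E2 petaE !(sqD (x - c)) sqN dN; rewrite /r in xr; lra.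
(* Its radius is half the distance from [p] to [c], so [c] is excluded and [T2] stays positive on
   [D]. *)
pose D := cball p (r / 4).
have r40 : 0 < r / 4 by rewrite divr_gt0.
have off x : sq (x - p) <= r / 4 -> x - c != 0.
  move=> xD; apply/eqP => /eqP; rewrite subr_eq0 => /eqP xc.
  have : sq (x - p) = r by rewrite xc -sqN opprB pc.
  by move: xD r40; rewrite /r; lra.
pose T2 x := \tr (A x *m ((x - c)^T *m (x - c))).
have T2pos x : sq (x - p) <= r / 4 -> 0 < T2 x.
  by move=> xD; rewrite /T2 tr_outer; have [_] := A_posdef x; apply; exact: off.
pose ratio x := (2 * \tr (A x) - dot (x - c) x) / T2 x.
have cT2 : continuous T2.
  apply: (@continuous_mxtrace R n (fun x => A x *m ((x - c)^T *m (x - c)))).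
  by apply: continuous_mulmx => //; exact: continuous_outer.
have crat : {within D, continuous ratio}%classic.
  apply: continuous_in_subspaceT => x; rewrite inE => xD.
  have c1 : {for x, continuous (fun x => \tr (A x))} by exact: continuous_mxtrace.
  have c2 : {for x, continuous (fun x => dot (x - c) x)} by exact: continuous_dotB.
  have c3 : {for x, continuous (fun x => (T2 x)^-1)}.
    exact: continuousV (lt0r_neq0 (T2pos x xD)) (cT2 x).
  have c4 := continuousM (@cst_continuous _ _ (2 : R) x) c1.
  exact: (continuousM (continuousB c4 c2) c3).
have D0 : (D !=set0)%classic by exists p; rewrite /D /cball /= subrr sq0 ltW.
have [e eD He] := compact_EVT_max D0 (@compact_cball R n p (r / 4)) crat.
(* By compactness a single [al] violates the conclusion of [interior_gaussian_test] on all of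
   [D]. *)
pose al := `|ratio e| + 1.
have al0 : 0 < al by rewrite ltr_wpDl.
have alP x : sq (x - p) <= r / 4 ->
    2 * \tr (A x) - dot (x - c) x < 4 * al * T2 x.
  move=> xD; have T20 := T2pos x xD.
  have := He x; rewrite inE => /(_ xD) hx.
  have h : ratio x < 4 * al.
    have := ler_norm (ratio e); rewrite /al; have := normr_ge0 (ratio e); lra.
  by move: h; rewrite /ratio ltr_pdivrMr.
pose kap := expR (- al * r).
pose psi eps x := Phi u x + eps * (expR (- al * sq (x - c)) - kap).
have cpsi eps : continuous (psi eps).
  move=> x; have c1 : {for x, continuous (Phi u)} by exact: cPhi.
  have c2 : {for x, continuous (fun x : 'rV[R]_n => sq (x - c))}.
    exact: continuous_sqB.
  have c3 := continuousM (@cst_continuous _ _ (- al) x) c2.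
  have c4 := @continuous_comp _ _ _ _ expR x c3 (@continuous_expR R _).
  have c5 := continuousB c4 (@cst_continuous _ _ kap x).
  exact: (continuousD c1 (continuousM (@cst_continuous _ _ eps x) c5)).
(* A maximum of [psi eps] over [D] lies on the sphere about [p]. As [Phi <= m], its value [>= m]
   forces the Gaussian above [kap], that is, [x] into the ball about [c]. *)
have boundary eps : 0 < eps -> exists x, [/\ sq (x - p) = r / 4, sq (x - c) <= r
     & m <= Phi u x + eps].
  move=> eps0.
  have [x xD Hx] := cball_max p (cpsi eps) (ltW r40).
  have psip : psi eps p = m by rewrite /psi pc /kap -/r subrr mulr0 addr0.
  have xm : m <= psi eps x.
    by rewrite -psip; apply: Hx; rewrite subrr sq0 ltW.
  have xb : sq (x - p) = r / 4.
    apply/eqP; rewrite eq_le xD /= leNgt; apply/negP => xin.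
    have := alP x xD; apply/negP; rewrite -leNgt.
    apply: (interior_gaussian_test (eps := eps) (kap := kap) al0 eps0) => y.
    have [del del0 Hd] := near_line_lt y (@continuous_sqB R n p) xin.
    by exists del => // t td; apply: Hx; apply: ltW; exact: Hd.
  exists x; split => //.
    have : kap <= expR (- al * sq (x - c)).
      rewrite -subr_ge0 -(pmulr_rge0 _ eps0).
      by have := Hq x; rewrite -/m; move: xm; rewrite /psi; lra.
    by rewrite /kap ler_expR !mulNr lerN2 ler_pM2l.
  have : expR (- al * sq (x - c)) <= 1.
    by rewrite -expR0 ler_expR mulNr oppr_le0 mulr_ge0 ?(ltW al0) // sq_ge0.
  by have := expR_gt0 (- al * r); rewrite -/kap; move: xm; rewrite /psi; nra.
(* On this compact set, which avoids [p], [Phi] stays below [m] by a fixed gap; an [eps] of half the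
   gap contradicts [boundary]. *)
pose S := (cball c r `&` ((fun x => sq (x - p)) @^-1` [set (r / 4)%R]))%classic.
have cS : compact S.
  rewrite /S; apply: compact_closedI; first exact: compact_cball.
  apply: preimage_closed; last exact: closed_eq.
  by move=> x _; exact: continuous_sqB.
have [x1 [x1p x1c _]] := boundary 1 ltr01.
have S1 : S x1 by split.
have [b bS Hb] := compact_EVT_max (ex_intro _ x1 S1) cS (continuous_subspaceT cPhi).
have bm : Phi u b < m.
  move: bS; rewrite inE => -[bc bp]; apply: touch => //; apply/eqP => E.
  by move: bp; rewrite /= E subrr sq0 => E'; move: r40; rewrite -E' ltxx.
have h0 : 0 < (m - Phi u b) / 2 by lra.
have [x [xp xc xm]] := boundary _ h0.
have := Hb x; rewrite inE => /(_ (conj xc xp)); lra.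
Qed.

End StrongMaximumPrinciple.

(** * Constant [Phi] forces a quadratic [u] *)

Section ConstantPhase.
Context {R : realType} {n : nat}.
Variable u : 'rV[R]_n -> R.
Hypothesis u_smooth : smooth u.

(** Along a ray from 0, [dPhi = 0] reads ['D_x u = t * hess2 x u] and [ddPhi = 0] makes [hess2 x u]
    constant, so [u x = 2^-1 * hess2 x u 0 - m]. *)
Lemma quadratic_of_constant_Phi (m : R) : (forall x, Phi u x = m) -> quadratic u.
Proof.
move=> Hm.
have key x : u x = 2^-1 * hess2 x u 0 - m.
  have D0 : (fun z : 'rV[R]_n => 'D_0 u z) = cst 0.
    by apply/funext => z; rewrite derive0.
  have Pc : (fun s : R => Phi u (0 + s *: x)) = cst m.
    by apply/funext => s; rewrite Hm.
  have P1 t : dPhi u 0 x t = 0.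
    have := is_derive_Phi 0 x t u_smooth; rewrite Pc => -[_ <-].
    exact: derive_cst.
  have P1c : dPhi u 0 x = cst 0 by apply/funext => t; exact: P1.
  have P2 t : ddPhi u 0 x t = 0.
    have := is_derive_dPhi 0 x t u_smooth; rewrite P1c => -[_ <-].
    exact: derive_cst.
  have d3 t := smooth_line 0 x t (smooth_derive x (smooth_derive x u_smooth)).
  (* The intermediate [t] is positive, so the factor [t] in [ddPhi] can be cancelled. *)
  have [t /andP[t0 _] E] := mvt d3 ltr01.
  have Z : hess2 x (cst (0 : R)) (0 + t *: x) = 0.
    rewrite /hess2; under eq_fun do rewrite derive_cst.
    exact: derive_cst.
  have := P2 t; rewrite /ddPhi D0 Z add0r => /eqP.
  rewrite mulf_eq0 invr_eq0 pnatr_eq0 /= mulf_eq0 (gt_eqF t0) /= => /eqP Z3.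
  have {}E : hess2 x u x = hess2 x u 0.
    apply/eqP; rewrite -subr_eq0; apply/eqP.
    move: E; rewrite scale1r scale0r !add0r -/(hess2 x u x) -/(hess2 x u 0) => ->.
    by rewrite -[X in X * _]/('D_x (hess2 x u) (t *: x)) -[t *: x]add0r Z3 mul0r.
  have := P1 1; rewrite /dPhi D0 derive_cst scale1r !add0r mul1r E => E1.
  have := Hm x; rewrite /Phi; move: E1; clear.
  by move: (u x) ('D_x u x) (hess2 x u 0) => a b d E1 E2; lra.
exists (2^-1 *: hessian u 0), 0, (- m) => x.
rewrite key -hessian_form // [X in _ + X + _]big1 => [|i _]; last by rewrite mxE mul0r.
rewrite addr0; congr (_ + _); rewrite mxE mulr_sumr exchange_big /=.
apply: eq_bigr => j _; rewrite mxE mulr_suml mulr_sumr; apply: eq_bigr => i _.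
by rewrite !mxE; ring.
Qed.

End ConstantPhase.

Theorem theorem1p2 (R : realType) (n : nat) (n_ge1 : (1 <= n)%N)
    (F : 'M[R]_n -> R) (DF : 'M[R]_n -> 'M[R]_n)
    (F_C1 : C1_on_spd F DF)
    (k1 C k2 : R) (k1_gt0 : 0 < k1) (C_gt0 : 0 < C) (k2_gt0 : 0 < k2)
    (DF_posdef : forall B : 'M[R]_n, spd R n B -> posdef_mx (DF B))
    (F_growth : forall B : 'M[R]_n, spd R n B ->
      expR (F B) <= C * ((\tr B) `^ k1 + 1))
    (DF_bound : forall B : 'M[R]_n, spd R n B ->
      operator_norm (DF B *m B) <= k2)
    (u : 'rV[R]_n -> R) (u_smooth : smooth u) (u_convex : strictly_convex u)
    (u_eq : forall x : 'rV[R]_n,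
      F (hessian u x) = 2^-1 * dot x (gradient u x) - u x) :
  quadratic u.
Proof.
have eqPhi x : F (hessian u x) = Phi u x.
  by rewrite u_eq dot_gradient //; exact: smooth_diff.
have [F_grad DF_cont] := F_C1.
have lin := linearized_equation F_grad DF_posdef DF_bound u_smooth u_convex eqPhi.
have growth x : expR (Phi u x) <= C * ((\tr (hessian u x)) `^ k1 + 1).
  by rewrite -eqPhi; apply: F_growth; exact: u_convex.
have [q Hq] : exists q, forall x, Phi u x <= Phi u q.
  apply: (Phi_attains_max (B := n%:R * k2) u_smooth u_convex k1_gt0 C_gt0 growth) => x.
  by have [s [_ E1 E2]] := lin x; exists s.
(* Continuity of the coefficients makes the barrier constant uniform on compact balls. *)
have A_cont : continuous (fun x => DF (hessian u x)).
  exact: continuous_within_comp DF_cont (continuous_hessian u_smooth) u_convex.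
have A_posdef x : posdef_mx (DF (hessian u x)) by apply: DF_posdef; exact: u_convex.
apply: (quadratic_of_constant_Phi u_smooth).
apply: (Phi_strong_maximum u_smooth A_cont A_posdef) Hq => x.
by have [s [E1 E2 _]] := lin x; exists s.
Qed.
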